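(* There exist tilings of the Euclidean plane by copies (obtained by rotation, reflection and translation) of the decorated hexagonal prototile, covering the whole plane without overlap, that satisfy both matching rules (R1) and (R2) everywhere; and no tiling of the plane by such copies that satisfies (R1) and (R2) everywhere is periodic, i.e. no such tiling is invariant (as a decorated tiling) under any nonzero translation.
   Context: The prototile. Take a regular hexagon (fixed side length) with vertices $v_0,\dots,v_5$ in counterclockwise order, indices mod 6. On each edge fix two points, symmetric about the edge's midpoint; a marking meeting the edge at one of them is said to meet it near the endpoint to which that point is closer. The prototile decoration consists of the following. Black stripes: a short curved stripe around $v_0$ joining edges $v_5v_0$ and $v_0v_1$ and meeting both near $v_0$; a short curved stripe around $v_3$ joining edges $v_2v_3$ and $v_3v_4$ and meeting both near $v_3$; and a long straight stripe joining the opposite edges $v_1v_2$ and $v_4v_5$, perpendicular to them and displaced from the center to one side: it meets them either near $v_1$ and $v_5$ (displaced toward $v_0$) or near $v_2$ and $v_4$ (displaced toward $v_3$). Colored diameters: diameter $v_1v_4$ is entirely red; diameter $v_2v_5$ is entirely blue; diameter $v_0v_3$ is the ''red–blue diameter'', one of its halves (from the center to a vertex) being red and the other blue. The colors stand for chirality of flags, so by convention every reflection interchanges red and blue. With this convention, the $12$ decorations of a hexagon obtained by choosing which of the three diameters plays the role of $v_0v_3$ (then, going counterclockwise by $60^\circ$ from it, the next diameter is red and the following one is blue), which of the two displacements the long stripe has, and which half of the red–blue diameter is red, are exactly the $12$ images of one single prototile under the six rotations and six reflections of the hexagon. Tilings: a tiling is a covering of the plane with no overlap by copies of the prototile; the hexagons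 then necessarily form the standard edge-to-edge tiling by regular hexagons. Rule (R1): black stripes are continuous across every edge, i.e. the two tiles sharing an edge have their black stripes meeting that edge at the same point. Rule (R2): for every edge of the tiling with endpoints $p,q$, let $t_p$ (resp. $t_q$) be the tile that has $p$ (resp. $q$) as a vertex but does not contain the edge $pq$; the half-diameter of $t_p$ ending at $p$ and the half-diameter of $t_q$ ending at $q$ (both collinear with the edge) must have different colors. *)

(* Defs.v *)
From HB Require Import structures.
From mathcomp Require Import all_boot all_order all_algebra.
From mathcomp Require Import all_classical all_reals all_analysis.
Import Order.TTheory GRing.Theory Num.Theory.
Import numFieldNormedType.Exports.

Set Implicit Arguments.
Unset Strict Implicit.
Unset Printing Implicit Defensive.

Local Open Scope classical_set_scope.
Local Open Scope ring_scope.

Notation plane R := 'rV[R]_2.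

Inductive color := Red | Blue.

Definition swap_color (c : color) : color :=
  match c with Red => Blue | Blue => Red end.

Section Prototile.
Variable R : realType.

Definition segment (p q : plane R) : set (plane R) :=
  [set x | exists t : R, 0 <= t <= 1 /\ x = p + t *: (q - p)].

(* The side length is the unit of length; arithmetic on indices is in 'Z_6. *)
Definition vertex (k : 'Z_6) : plane R :=
  let a : R := (nat_of_ord k)%:R * (pi / 3) in
  \row_(j < 2) (if j == 0 then cos a else sin a).

Definition hexagon : set (plane R) :=
  [set x | exists w : 'Z_6 -> R,
     [/\ forall k, 0 <= w k, \sum_k w k = 1 & x = \sum_k w k *: vertex k]].

(* [mark d i j] is the marked point near [vertex i] on the edge joining
   [vertex i] and [vertex j]; with 0 < d < 1/2, [mark d i j] and [mark d j i]
   are distinct and symmetric about the midpoint of that edge. *)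
Definition mark (d : R) (i j : 'Z_6) : plane R :=
  vertex i + d *: (vertex j - vertex i).

(* A black stripe is given by its two end points: the course of the curve
   inside the hexagon is irrelevant to the matching rules.  The long stripe is
   displaced toward vertex 0; displacing it toward vertex 3, or exchanging the
   colors of the two halves of the red-blue diameter, gives the image of this
   prototile under an isometry of the hexagon (reflections swapping colors). *)
Definition black_stripes (d : R) : seq (plane R * plane R) :=
  [:: (mark d 0 5, mark d 0 1);
      (mark d 3 2, mark d 3 4);
      (mark d 1 2, mark d 5 4)].

Definition black_ends (d : R) : set (plane R) :=
  [set x | x \in unzip1 (black_stripes d) ++ unzip2 (black_stripes d)].

(* Color of the half-diameter from the center to [vertex k]. *)
Definition half_color (k : 'Z_6) : color :=
  match nat_of_ord k with
  | 0 => Red | 3 => Blue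
  | 1 | 4 => Red
  | _ => Blue
  end%N.

End Prototile.

Section Tilings.
Variable R : realType.

(* The image of the prototile under x |-> x *m lin + shift.  The decorated
   prototile has no nontrivial symmetry, so a decorated tile determines its
   placement, and a set of decorated tiles is the same as a set of
   placements. *)
Record placement := Placement { lin : 'M[R]_2; shift : plane R }.

Definition is_isometry (g : placement) : Prop := lin g *m (lin g)^T = 1%:M.

Definition reverses_orientation (g : placement) : bool := \det (lin g) < 0.

Definition place (g : placement) (x : plane R) : plane R :=
  x *m lin g + shift g.

Definition tile (g : placement) : set (plane R) := place g @` @hexagon R.

Definition tile_vertex (g : placement) (k : 'Z_6) : plane R :=
  place g (vertex R k).

Definition tile_edge (g : placement) (p q : plane R) : Prop :=
  exists k : 'Z_6,
    (p = tile_vertex g k /\ q = tile_vertex g (k + 1)) \/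
    (q = tile_vertex g k /\ p = tile_vertex g (k + 1)).

Definition tile_black_ends (d : R) (g : placement) : set (plane R) :=
  place g @` black_ends d.

(* Every reflection interchanges red and blue. *)
Definition tile_half_color (g : placement) (k : 'Z_6) : color :=
  if reverses_orientation g then swap_color (half_color k) else half_color k.

Definition is_tiling (T : set placement) : Prop :=
  [/\ forall g, T g -> is_isometry g,
      \bigcup_(g in T) tile g = setT
    & trivIset T (fun g => interior (tile g))].

Definition rule_R1 (d : R) (T : set placement) : Prop :=
  forall g h p q, T g -> T h -> tile_edge g p q -> tile_edge h p q ->
    tile_black_ends d g `&` segment p q = tile_black_ends d h `&` segment p q.

Definition rule_R2 (T : set placement) : Prop :=
  forall g p q, T g -> tile_edge g p q ->
  forall tp i, T tp -> tile_vertex tp i = p -> ~ tile_edge tp p q ->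
  forall tq j, T tq -> tile_vertex tq j = q -> ~ tile_edge tq p q ->
    tile_half_color tp i <> tile_half_color tq j.

Definition translate (t : plane R) (g : placement) : placement :=
  Placement (lin g) (shift g + t).

Definition periodic_tiling (T : set placement) : Prop :=
  exists t : plane R, t <> 0 /\ translate t @` T = T.

End Tilings.

(* Main.v *)
Require Import Defs.
From HB Require Import structures.
From mathcomp Require Import all_boot all_order all_algebra.
From mathcomp Require Import all_classical all_reals all_analysis.
From mathcomp Require Import zify ring lra.
Import Order.TTheory GRing.Theory Num.Theory.
Import numFieldNormedType.Exports.
Set Implicit Arguments.
Unset Strict Implicit.
Unset Printing Implicit Defensive.
Local Open Scope classical_set_scope.
Local Open Scope ring_scope.

(** The tiles are regular hexagons, and the first half of the argument reduces
    tilings to decorations of the cells of one hexagonal grid.  The centers of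
    two tiles are at least sqrt 3 apart, because inscribed disks are disjoint
    ([centers_apart]), and a tile lies within distance 1 of its center.  At a
    vertex v of a tile, covering points just outside the tile on both sides
    produces two more tiles containing v ([tiling_locally], [tiling_star]).
    Three centers within distance 1 of v and pairwise sqrt 3 apart must form an
    equilateral triangle around v ([three_centers]), so the neighbors of a tile
    are exactly where the grid wants them and, having v as a vertex, are aligned
    with it ([dihedral_align]).  Hence a tiling is the same thing as a function
    from the triangular lattice of centers to the twelve symmetries of the
    hexagon ([tiling_is_lattice], [lattice_is_tiling]), and the two rules become
    local conditions on this function ([lattice_R1], [lattice_R2], [matching]).

    Both rules act along lattice lines.  Following a line that crosses opposite
    edges, a long stripe transmits the side on which it meets the edge, while
    the curved stripes impose that side; following a line of collinear
    diameters, a red-blue diameter transmits a color alternation while the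
    others impose their color.  Call a cell a hub if its six neighbors have the
    axes that make their long stripes point at it.  Looking at a cell and its
    six neighbors, the rules allow only two situations: the cell is a hub, or it
    has a small black triangle at both ends of its red-blue axis
    ([hub_or_full]).  This local dichotomy forces the hubs to form exactly a
    coset of the doubled lattice ([hub_exists], [hub_step], [hub_parity]).  All
    other tiles then merely transmit marks and colors from hub to hub, so that
    the hubs themselves carry a function satisfying the same conditions at twice
    the scale ([hub_matching]).  A period maps hubs to hubs, so it is divisible
    by 2, and its half is a period at the coarser scale; repeating this, a
    period is divisible by every power of 2 and vanishes
    ([matching_nonperiodic]).

    Conversely, the hierarchy can be prescribed: declare the cells of the
    doubled lattice to be the hubs, and likewise at every scale.  Then the axis
    of a tile is determined by the class modulo 2 of its position divided by the
    largest possible power of 2, and what it transmits is determined by the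
    preceding tile on the line that does not transmit, which gives a closed
    formula in terms of 2-adic valuations ([signal],
    [toeplitz], [toeplitz_matching]). *)

(** * Decorated tiles on the triangular lattice *)

Lemma Z6_ind (P : 'Z_6 -> Prop) :
  P 0 -> P 1 -> P 2 -> P 3 -> P 4 -> P 5 -> forall k, P k.
Proof.
move=> P0 P1 P2 P3 P4 P5 k.
have : [|| k == 0, k == 1, k == 2, k == 3, k == 4 | k == 5].
  by case: k => [[|[|[|[|[|[|]]]]]]].
by case/or4P => [/eqP->|/eqP->|/eqP->|/orP[/eqP->|/orP[/eqP->|/eqP->]]].
Qed.

(** The six neighbors of the origin in the lattice of tile centers, [dir k]
    lying across the edge from vertex [k] to vertex [k + 1].  The same integer
    pairs are the coordinates of [vertex k] in the basis formed by vertex 0 and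
    vertex 1, since both families are regular hexagons. *)
Definition dir (k : 'Z_6) : int * int :=
  nth (0, 0) [:: (1, 0); (0, 1); (-1, 1); (-1, 0); (0, -1); (1, -1)] k.

Lemma dirD k : dir (k + 1) = dir k + dir (k + 2).
Proof. by elim/Z6_ind: k. Qed.
Lemma dirN k : dir (k + 3) = - dir k.
Proof. by elim/Z6_ind: k. Qed.

Lemma lattice_ind (P : int * int -> Prop) :
  P 0 -> (forall z k, P z -> P (z + dir k)) -> forall z, P z.
Proof.
move=> P0 PS.
have PN k (n : nat) z : P z -> P (z + (n%:Z * (dir k).1, n%:Z * (dir k).2)).
  move=> Pz; elim: n => [|n IH]; first by rewrite !mul0r addr0.
  rewrite intS !mulrDl !mul1r addrC.
  rewrite [(_ + _, _)](_ : _ = dir k + (n%:Z * (dir k).1, n%:Z * (dir k).2)).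
    by rewrite -addrA addrC; apply: PS; rewrite addrC.
  by case: (dir k).
case=> x y; have PX : P (x, 0).
  have [m E] : exists m : nat, x = m%:Z \/ x = - m%:Z by exists `|x|%N; lia.
  case: E => ->; [have := PN 0 m _ P0 | have := PN 3 m _ P0];
    by rewrite add0r /dir /= ?mulr0 ?mulr1 ?mulrN1.
have [m E] : exists m : nat, y = m%:Z \/ y = - m%:Z by exists `|y|%N; lia.
case: E => ->; [have := PN 1 m _ PX | have := PN 4 m _ PX];
  rewrite /dir /= ?mulr0 ?mulr1 ?mulrN1; congr P; congr (_, _); rewrite /=; lia.
Qed.

(** A placement of the prototile in a given cell: [(r, s)] carries vertex [0]
    to position [r], after a reflection if [s] holds. *)
Definition orient := ('Z_6 * bool)%type.

Definition turn (t : orient) (k : 'Z_6) : 'Z_6 :=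
  if t.2 then t.1 - k else t.1 + k.

(** Whether the stripe crosses the edge from position [k] to [k + 1] near
    [k + 1] rather than near [k].  The pattern of stripes is symmetric about the
    line through vertices 0 and 3, so it depends only on the position [r] of
    vertex 0. *)
Definition toward (r k : 'Z_6) : bool :=
  let j : 'Z_6 := k - r in
  nth false [:: false; false; true; false; true; true] j.

Definition shade (t : orient) (k : 'Z_6) : color :=
  if t.2 then swap_color (half_color (t.1 - k)) else half_color (k - t.1).

(** The red-blue diameter joins the positions [a] and [a + 3]. *)
Definition axis (r a : 'Z_6) : bool := (r == a) || (r == a + 3).

(** The two rules for an assignment of decorations to the cells.  The edge of
    [z] in direction [k] is the edge of [z + dir k] in direction [k + 3], run
    through backwards, whence the negation.  The vector [dir k + dir (k + 5)] is
    three times the vector from a center to its vertex [k]: the half-diameters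
    of the two tiles that it relates point at each other along a common line,
    separated by one edge. *)
Definition matching (f : int * int -> orient) : Prop :=
  (forall z k, toward (f (z + dir k)).1 (k + 3) = ~~ toward (f z).1 k) /\
  (forall z k, shade (f (z + (dir k + dir (k + 5)))) (k + 3) <> shade (f z) k).

(* Closes an identity of directions or indices depending on [a] alone. *)
Ltac Z6 a := by try apply/eqP; clear - a; elim/Z6_ind: a.

Lemma axisP a r : [\/ axis r a, axis r (a + 1) | axis r (a + 2)].
Proof.
by elim/Z6_ind: a; elim/Z6_ind: r;
  (by apply: Or31) || (by apply: Or32) || (by apply: Or33).
Qed.

Lemma axis_half a r : axis r (a + 3) = axis r a.
Proof. rewrite /axis orbC -addrA; congr (_ || _); congr (_ == _). Z6 a. Qed.

Lemma axis_ind (P : 'Z_6 -> Prop) a :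
  P a -> P (a + 3) -> forall r, axis r a -> P r.
Proof. by move=> P0 P3 r /orP[] /eqP->. Qed.

Lemma toward_axis a r : axis r a ->
  [/\ toward r a = false, toward r (a + 2) = true, toward r (a + 3) = false,
      toward r (a + 5) = true & toward r (a + 4) = ~~ toward r (a + 1)].
Proof. by move: r; apply: axis_ind; elim/Z6_ind: a. Qed.

Lemma shade_axis a t : axis t.1 a ->
  [/\ shade t (a + 1) = Red, shade t (a + 2) = Blue, shade t (a + 4) = Red,
      shade t (a + 5) = Blue & shade t (a + 3) = swap_color (shade t a)].
Proof. by case: t => r s /=; move: r; apply: axis_ind; elim/Z6_ind: a; case: s. Qed.

Section Matching.
Variable f : int * int -> orient.
Hypothesis fM : matching f.

Lemma stripe_matches z k w l : w = z + dir k -> l = k + 3 ->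
  toward (f w).1 l = ~~ toward (f z).1 k.
Proof. by case: fM => H _ -> ->; exact: H. Qed.

Lemma shade_differs z k w l : w = z + (dir k + dir (k + 5)) -> l = k + 3 ->
  shade (f w) l <> shade (f z) k.
Proof. by case: fM => _ H -> ->; exact: H. Qed.

(** The centers of the coarser tiling hidden in a matching: the red-blue axis
    of each of the six neighbors is parallel to the side of [z] that the
    neighbor touches. *)
Definition hub z := forall k, axis (f (z + dir k)).1 (k + 2).

(** Around the end [a] of the red-blue axis of [z], the stripe rule on the three
    edges meeting there leaves two possibilities: the three tiles close up a
    small black triangle, or the position of vertex 0 is determined in both
    neighbors. *)
Lemma full_or_split z a : axis (f z).1 a ->
  let r' := (f (z + dir a)).1 in let r'' := (f (z + dir (a + 5))).1 in
  axis r' (a + 1) /\ axis r'' (a + 2) \/ r' = a + 5 /\ r'' = a + 1.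
Proof.
move=> za /=.
have E1 := stripe_matches (z := z) (k := a) erefl erefl.
have E2 : toward (f (z + dir (a + 5))).1 (a + 2) = ~~ toward (f z).1 (a + 5).
  by apply: stripe_matches => //; Z6 a.
have E3 : toward (f (z + dir a)).1 (a + 4)
    = ~~ toward (f (z + dir (a + 5))).1 (a + 1).
  apply: stripe_matches; last by Z6 a.
  by rewrite -addrA; congr (_ + _); Z6 a.
move: (f (z + dir a)).1 (f (z + dir (a + 5))).1 E1 E2 E3 => r' r''.
have [-> _ _ -> _] := toward_axis za => /= E1 E2 E3.
case: (axisP a r') => r'a.
- by have [_ _ + _ _] := toward_axis r'a; rewrite E1.
- left; split=> //; have E4 : toward r' (a + 4) = false.
    by have [_ _ + _ _] := toward_axis r'a; rewrite -addrA; congr (toward _ _ = _); Z6 a.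
  case: (axisP a r'') => // r''a; have [F0 F2 _ _ _] := toward_axis r''a.
    by rewrite E2 in F2.
  by rewrite E4 F0 in E3.
- have r'E : r' = a + 5.
    apply/eqP; move: r' r'a E1 {E3}; apply: axis_ind; clear - a; by elim/Z6_ind: a.
  right; split=> //; apply/eqP; move: E3 E2; rewrite {}r'E; clear - a.
  by elim/Z6_ind: a; elim/Z6_ind: r''.
Qed.

(** Small black triangles sit at both ends of the red-blue axis of [z]. *)
Definition full z := forall a, axis (f z).1 a ->
  axis (f (z + dir a)).1 (a + 1) /\ axis (f (z + dir (a + 5))).1 (a + 2).

(** One end without a small triangle fixes the two tiles there.  Applied to the
    diameters that pass beside [z], the color rule together with the stripe rule
    then fixes the axes in directions [a + 1] and [a + 4], and forbids a small
    triangle at the other end of the axis. *)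
Lemma hub_of_split z a : axis (f z).1 a ->
  (f (z + dir a)).1 = a + 5 -> (f (z + dir (a + 5))).1 = a + 1 -> hub z.
Proof.
move=> za n0 n5.
have x0 : axis (f (z + dir a)).1 (a + 2) by rewrite n0; Z6 a.
have x5 : axis (f (z + dir (a + 5))).1 (a + 1) by rewrite n5 /axis eqxx.
have x1 : axis (f (z + dir (a + 1))).1 a.
  have E : toward (f (z + dir (a + 1))).1 (a + 5) = true.
    rewrite (@stripe_matches (z + dir a) (a + 2)); first by rewrite n0; Z6 a.
      by rewrite -addrA -dirD.
    by Z6 a.
  have C : shade (f (z + dir (a + 1))) (a + 5) <> shade (f (z + dir (a + 5))) (a + 2).
    by apply: shade_differs; [rewrite -addrA; congr (_ + _); Z6 a | Z6 a].
  case: (axisP a (f (z + dir (a + 1))).1) => // x1.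
    case: C; have [_ _ + _ _] := shade_axis x1; have [+ _ _ _ _] := shade_axis x5.
    have -> : a + 1 + 4 = a + 5 by Z6 a.
    have -> : a + 1 + 1 = a + 2 by Z6 a.
    by move=> -> ->.
  have [_ _ + _ _] := toward_axis x1; rewrite -addrA; have -> : 2 + 3 = 5 :> 'Z_6 by apply/eqP.
  by rewrite E.
have x4 : axis (f (z + dir (a + 4))).1 a.
  have E : toward (f (z + dir (a + 4))).1 a = false.
    rewrite (@stripe_matches (z + dir (a + 5)) (a + 3)); first by rewrite n5; Z6 a.
      by rewrite -addrA; congr (_ + _); Z6 a.
    by Z6 a.
  have C : shade (f (z + dir (a + 4))) (a + 1) <> shade (f (z + dir a)) (a + 4).
    by apply: shade_differs; [rewrite -addrA; congr (_ + _); Z6 a | Z6 a].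
  case: (axisP a (f (z + dir (a + 4))).1) => // x4.
    have [_ _ _ + _] := toward_axis x4; rewrite -addrA.
    have -> : a + (1 + 5) = a by Z6 a.
    by rewrite E.
  case: C; have [_ _ _ + _] := shade_axis x4; have [_ + _ _ _] := shade_axis x0.
  have -> : a + 2 + 5 = a + 1 by Z6 a.
  have -> : a + 2 + 2 = a + 4 by Z6 a.
  by move=> -> ->.
have z3 : axis (f z).1 (a + 3) by rewrite axis_half.
have [x3 x2] : axis (f (z + dir (a + 3))).1 (a + 5) /\
    axis (f (z + dir (a + 2))).1 (a + 4).
  have := full_or_split z3.
  have -> : a + 3 + 5 = a + 2 by Z6 a.
  case=> [[_ x2] | [-> ->]]; last by split; Z6 a.
  have x2' : axis (f (z + dir (a + 2))).1 (a + 2) by move: x2; rewrite -axis_half;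
    congr axis; Z6 a.
  have [] : shade (f (z + dir a)) (a + 3) <> shade (f (z + dir (a + 2))) a.
    by apply: shade_differs => //; rewrite -addrA; congr (_ + _); Z6 a.
  have [_ _ + _ _] := shade_axis x2'; have [+ _ _ _ _] := shade_axis x0.
  have -> : a + 2 + 1 = a + 3 by Z6 a.
  have -> : a + 2 + 4 = a by Z6 a.
  by move=> -> ->.
have K k : [|| k == a, k == a + 1, k == a + 2, k == a + 3, k == a + 4 | k == a + 5].
  by clear - a k; elim/Z6_ind: a; elim/Z6_ind: k.
move=> k; case/or4P: (K k) => [/eqP->|/eqP->|/eqP->|/orP[/eqP->|/orP[/eqP->|/eqP->]]] //.
- by rewrite (_ : a + 1 + 2 = a + 3) ?axis_half //; Z6 a.
- by rewrite (_ : a + 2 + 2 = a + 4) //; Z6 a.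
- by rewrite (_ : a + 3 + 2 = a + 5) //; Z6 a.
- by rewrite (_ : a + 4 + 2 = a) //; Z6 a.
- by rewrite (_ : a + 5 + 2 = a + 1) //; Z6 a.
Qed.

Lemma hub_or_full z : hub z \/ full z.
Proof.
have [h|nh] := pselect (hub z); [by left|right=> a za].
by case: (full_or_split za) => // -[n0 n5]; case: nh; apply: hub_of_split za n0 n5.
Qed.

(** Adjacent hubs would impose two different axes on their common neighbors. *)
Lemma hub_nbr z k : hub z -> ~ hub (z + dir k).
Proof.
move=> hz /(_ (k + 2)); rewrite -addrA -dirD.
have := hz (k + 1); move: (f _).1 => r; clear - k.
by elim/Z6_ind: k; elim/Z6_ind: r.
Qed.

(** The directions [j] of the two full ends of a tile that is not a hub agree
    modulo 3, so they occur among any three consecutive directions, and the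
    neighbor in such a direction has an axis that a hub would not allow. *)
Lemma hub_of_three z k : axis (f (z + dir k)).1 (k + 2) ->
  axis (f (z + dir (k + 1))).1 (k + 3) -> axis (f (z + dir (k + 2))).1 (k + 4) ->
  hub z.
Proof.
move=> x0 x1 x2; case: (hub_or_full z) => // zf.
have [j [jz jx]] : exists j, axis (f z).1 j /\ axis (f (z + dir j)).1 (j + 2).
  case: (axisP k (f z).1) => zk; [exists k | exists (k + 1) | exists (k + 2)];
  by split=> //; rewrite -addrA.
have [+ _] := zf _ jz; move: jx; move: (f (z + dir j)).1 => r; clear - r j.
by elim/Z6_ind: j; elim/Z6_ind: r.
Qed.

(** If the tile at the origin is full, its own axis and its two small triangles
    determine three consecutive neighbors of the cell in direction [a + 1], which
    makes that cell a hub. *)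
Lemma hub_exists : exists z, hub z.
Proof.
have [h|zf] := hub_or_full 0; first by exists 0.
have {zf} K a : axis (f 0).1 a -> axis (f (dir a)).1 (a + 1) /\
   axis (f (dir (a + 5))).1 (a + 2).
  by move=> /zf; rewrite !add0r.
pose a := (f 0).1; have a0 : axis (f 0).1 a by rewrite /axis eqxx.
exists (dir (a + 1)); apply: (@hub_of_three _ (a + 3)).
- have [_ +] := K (a + 3) (etrans (axis_half _ _) a0).
  have -> : dir (a + 1) + dir (a + 3) = dir (a + 3 + 5) by Z6 a.
  by [].
- have -> : dir (a + 1) + dir (a + 3 + 1) = 0 by Z6 a.
  by have -> : a + 3 + 3 = a by Z6 a.
- have [+ _] := K a a0.
  have -> : dir (a + 1) + dir (a + 3 + 2) = dir a by Z6 a.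
  by have -> : a + 3 + 4 = a + 1 by Z6 a.
Qed.

(** The tile between [z] and [z + 2 dir k] is full, being next to a hub; its axis
    and its two small triangles determine three neighbors of [z + 2 dir k]. *)
Lemma hub_step z k : hub z -> hub (z + (dir k + dir k)).
Proof.
move=> hz; have [h|yf] := hub_or_full (z + dir k).
  by case: (hub_nbr hz h).
have [_ x1] := yf _ (hz k).
have k5 : axis (f (z + dir k)).1 (k + 5).
  by rewrite (_ : k + 5 = k + 2 + 3) ?axis_half //; Z6 k.
have [x5 _] := yf _ k5.
apply: (@hub_of_three _ (k + 2)).
- have -> : z + (dir k + dir k) + dir (k + 2) = z + dir k + dir (k + 2 + 5).
    by rewrite -!addrA; congr (_ + _); Z6 k.
  by [].
- have -> : z + (dir k + dir k) + dir (k + 2 + 1) = z + dir k.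
    by rewrite -!addrA; congr (_ + _); Z6 k.
  by have -> : k + 2 + 3 = k + 5 by Z6 k.
- have -> : z + (dir k + dir k) + dir (k + 2 + 2) = z + dir k + dir (k + 5).
    by rewrite -!addrA; congr (_ + _); Z6 k.
  by have -> : k + 2 + 4 = k + 5 + 1 by Z6 k.
Qed.

Lemma hub_even z w : hub z -> hub (z + (w + w)).
Proof.
move=> hz; elim/lattice_ind: w => [|w k hw]; first by rewrite !addr0.
by rewrite (addrACA w) (addrA z); apply: hub_step.
Qed.

(** Representatives of the four classes of the lattice modulo its double. *)
Lemma half_cases (z : int * int) :
  (exists w, z = w + w) \/
  exists w, exists2 k, k \in [:: 0; 1; 2] & z = w + w + dir k.
Proof.
case: z => x y.
have [x' [bx ->]] : exists x' (b : bool), x = x' + x' + b%:Z.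
  by exists (x %/ 2)%Z, (odd `|x|); lia.
have [y' [by' ->]] : exists x' (b : bool), y = x' + x' + b%:Z.
  by exists (y %/ 2)%Z, (odd `|y|); lia.
case: bx; case: by'.
- by right; exists (x' + 1, y'), 2 => //; congr (_, _); rewrite /=; lia.
- by right; exists (x', y'), 0 => //; congr (_, _); rewrite /=; lia.
- by right; exists (x', y'), 1 => //; congr (_, _); rewrite /=; lia.
- by left; exists (x', y'); congr (_, _); rewrite /=; lia.
Qed.

Lemma hub_parity z t : hub z -> hub (z + t) -> exists w, t = w + w.
Proof.
move=> hz ht; case: (half_cases t) => // -[w [k _ E]].
by case: (hub_nbr (k := k) (hub_even w hz)); rewrite -addrA -E.
Qed.

(** The hubs carry a matching on a doubled lattice.  Between two hubs that
    become adjacent there is one tile, whose long stripe transmits the mark, and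
    between two hubs related by the color rule there is one tile, whose
    red-blue diameter transmits the color. *)
Lemma hub_matching z : hub z -> matching (fun w => f (z + (w + w))).
Proof.
move=> hz; split=> w k.
- set y := z + (w + w) + dir k.
  have ky : axis (f y).1 (k + 2) by exact: hub_even.
  rewrite (@stripe_matches y k) //; last by rewrite /y (addrACA w) !addrA.
  have <- : toward (f y).1 (k + 3) = ~~ toward (f (z + (w + w))).1 k.
    exact: stripe_matches.
  have [_ _ _ _] := toward_axis ky.
  have -> : k + 2 + 4 = k by Z6 k.
  have -> : k + 2 + 1 = k + 3 by Z6 k.
  by move=> ->; rewrite negbK.
- set W := dir k + dir (k + 5); set y := z + (w + w) + W.
  have ky : axis (f y).1 k.
    have := hub_even (w + dir (k + 5)) hz (k + 1).
    rewrite (_ : _ + dir (k + 1) = y); last first.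
      by rewrite /y /W (addrACA w) -!addrA; congr (_ + (_ + (_ + _))); Z6 k.
    by rewrite (_ : k + 1 + 2 = k + 3) ?axis_half //; Z6 k.
  have C1 : shade (f (z + (w + W + (w + W)))) (k + 3) <> shade (f y) k.
    by apply: shade_differs => //; rewrite /y (addrACA w) !addrA.
  have C2 : shade (f y) (k + 3) <> shade (f (z + (w + w))) k by exact: shade_differs.
  have [_ _ _ _ E] := shade_axis ky; move: C2 C1; rewrite E.
  by case: (shade (f y) k); case: (shade _ k); case: (shade _ _).
Qed.
End Matching.

(** A period permutes the hubs, hence is even, and its half is a period of the
    matching carried by the hubs: infinite descent. *)
Lemma matching_nonperiodic f t : matching f -> (forall z, f (z + t) = f z) -> t = 0.
Proof.
have [n] := ubnP (`|t.1| + `|t.2|)%N.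
elim: n f t => // n IH f t tn fM ft.
have [z hz] := hub_exists fM.
have [w tE] : exists w, t = w + w.
  by apply: (hub_parity fM hz) => k; rewrite -addrA (addrC t) addrA ft.
have [w0|w0] := eqVneq w 0; first by rewrite tE w0 addr0.
suff w1 : w = 0 by rewrite w1 eqxx in w0.
apply: (IH _ w _ (hub_matching fM hz)) => [|u]; last first.
  by rewrite /= (addrACA u) -tE addrA ft.
by move: tn w0; rewrite tE; case: w {tE} => x y /=; rewrite -[_ == _]/((x == 0) && (y == 0)); lia.
Qed.

(** * A matching of the lattice *)

(** Along a lattice line, marks (or colors) facing forward form a binary
    sequence.  On the line at height [y], where [2 ^ v] is the exact power of 2
    dividing [y], the value is passed on by the tiles at positions not divisible
    by [2 ^ v], which belong to lower levels of the hierarchy, and changes at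
    each multiple of [2 ^ v].  On the line [y = 0] every tile except the one
    at the origin passes the value on, so that the line carries one value [b0]
    from the origin on and one value [b1] before it. *)
Definition signal (b0 b1 : bool) (z : int * int) : bool :=
  if z.2 == 0 then if 0 <= z.1 then b0 else b1
  else odd `|(z.1 %/ (2 ^ logn 2 `|z.2|)%N%:Z)%Z|.

Lemma signal_odd b0 b1 x y : odd `|y| -> signal b0 b1 (x, y) = odd `|x|.
Proof.
move=> oy; rewrite /signal /=; have -> : (y == 0) = false by lia.
have -> : logn 2 `|y| = 0%N by rewrite lognE dvdn2 oy /= andbF.
by rewrite divz1.
Qed.

Lemma signal_half b0 b1 x y (b : bool) :
  signal b0 b1 (x + x + b%:Z, y + y) = signal b0 b1 (x, y).
Proof.
rewrite /signal /=; have -> : (y + y == 0) = (y == 0) by lia.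
case: eqP => y0; first by have -> : (0 <= x + x + b%:Z) = (0 <= x) by lia.
have -> : absz (y + y) = (2 * absz y)%N by lia.
rewrite lognM; [|lia..]; rewrite (lognE 2 2) /= expnD expn1 PoszM divzMA_ge0 //.
by have -> : ((x + x + b%:Z) %/ 2%N)%Z = x by lia.
Qed.

Lemma signal_double b0 b1 z : signal b0 b1 (z + z) = signal b0 b1 z.
Proof. by case: z => x y; rewrite -(signal_half _ _ _ _ false) addr0. Qed.

Lemma signal_pred b0 b1 (u : int * int) :
  signal b0 b1 (u + u - (1, 0)) = signal b0 b1 (u - (1, 0)).
Proof.
case: u => x y; rewrite -[RHS](signal_half _ _ _ _ true).
congr (signal _ _ (_, _)); rewrite /=; lia.
Qed.

Lemma signal_class b0 b1 u (e : int * int) (b : bool) :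
  odd `|e.2| && (odd `|e.1| == b) ->
  signal b0 b1 (u + u + e) = b /\
  signal b0 b1 (u + u + e - (1, 0)) = ~~ signal b0 b1 (u + u + e).
Proof.
by case: u e => x y [a c] /= ?; rewrite !signal_odd /=; lia.
Qed.

Lemma signal_pass b0 b1 (u e : int * int) : odd `|e.1| -> ~~ odd `|e.2| ->
  signal b0 b1 (u + u + e - (1, 0)) = signal b0 b1 (u + u + e).
Proof.
case: u e => x y [a b] /= oa ob.
rewrite [RHS](_ : _ = signal b0 b1 (x + ((a - 1) %/ 2)%Z, y + (b %/ 2)%Z)).
  rewrite -(signal_half _ _ _ _ false); congr (signal _ _ (_, _)); rewrite /=; lia.
rewrite -(signal_half _ _ _ _ true); congr (signal _ _ (_, _)); rewrite /=; lia.
Qed.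

(** The scale of the hierarchy to which a cell [z <> 0] belongs; the value 1 at
    the origin is a default. *)
Definition level (z : int * int) : int := (2 ^ logn 2 (gcdn `|z.1| `|z.2|))%N%:Z.

(** The direction of the long stripe of the tile at [z], read off from the class
    modulo 2 of [z] divided by its level. *)
Definition longdir (z : int * int) : 'Z_6 :=
  if ~~ odd `|(z.2 %/ level z)%Z| then 0
  else if ~~ odd `|(z.1 %/ level z)%Z| then 1 else 2.

Lemma level_double z : z != 0 -> level (z + z) = 2 * level z.
Proof.
case: z => x y z0; rewrite /level /=.
have -> : absz (x + x) = (2 * absz x)%N by lia.
have -> : absz (y + y) = (2 * absz y)%N by lia.
rewrite -muln_gcdr lognM //; first by rewrite (lognE 2 2) /= expnD expn1 PoszM.
rewrite gcdn_gt0; move: z0; rewrite -[_ == _]/((x == 0) && (y == 0)); lia.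
Qed.

Lemma longdir_double z : longdir (z + z) = longdir z.
Proof.
have [->|z0] := eqVneq z 0; first by rewrite addr0.
rewrite /longdir level_double // -[(z + z).1]/(z.1 + z.1) -[(z + z).2]/(z.2 + z.2).
have E (a l : int) : ((a + a) %/ (2 * l))%Z = (a %/ l)%Z.
  by rewrite (_ : a + a = 2 * a) ?divzMpl //; ring.
by rewrite !E.
Qed.

Lemma level_odd z : odd `|z.1| || odd `|z.2| -> level z = 1.
Proof.
move=> oz; rewrite /level lognE dvdn_gcd !dvdn2 -negb_or oz /=.
by rewrite andbF.
Qed.

Lemma longdir_odd k w : k \in [:: 0; 1; 2] -> longdir (w + w + dir k) = k.
Proof.
rewrite !inE => /or3P[] /eqP->; case: w => x y; rewrite /longdir level_odd /= ?divz1 /=;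
  do ?[case: ifP => //=]; lia.
Qed.

(** Coordinates in the basis [(dir 1, dir 2)] from those in [(dir 0, dir 1)]. *)
Definition turnback (z : int * int) : int * int := (z.1 + z.2, - z.1).

(** Coordinates in the basis [(dir k, dir (k + 1))]. *)
Definition along (k : nat) (z : int * int) := iter k turnback z.
(** Coordinates in the basis [(dir k + dir (k + 5), dir k)]; the first vector
    spans the line on which the color rule acts in direction [k]. *)
Definition athwart (k : nat) (z : int * int) : int * int :=
  (- (along k z).2, (along k z).1 + 2 * (along k z).2).

Lemma alongD k z w : along k (z + w) = along k z + along k w.
Proof.
elim: k => // k IH; rewrite /along !iterS -!/(along _ _) IH.
case: (along k z) (along k w) => x y [a b]; rewrite /turnback.
by congr (_, _); rewrite /=; lia.
Qed.

Lemma athwartD k z w : athwart k (z + w) = athwart k z + athwart k w.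
Proof.
rewrite /athwart alongD; case: (along k z) (along k w) => x y [a b].
by congr (_, _); rewrite /=; lia.
Qed.

Definition is_blue c := if c is Blue then true else false.

(** The tile at the origin, which fixes the values of the signals on the lines
    through the origin. *)
Definition seed : orient := (2, false).

Definition front (k : 'Z_6) (z : int * int) :=
  signal (toward seed.1 k) (~~ toward seed.1 (k + 3)) (along k z).
Definition tint (k : 'Z_6) (z : int * int) :=
  signal (is_blue (shade seed k)) (~~ is_blue (shade seed (k + 3))) (athwart k z).

(** A long stripe in direction [k] is perpendicular to the diameter through
    [k - 1]; this is the representative of that diameter among 0, 1, 2. *)
Definition rb_axis (k : 'Z_6) : 'Z_6 := if k == 0 then 2 else k - 1.

(** The self-similar matching.  Its axis comes from the class of [z]; the end of
    the axis toward which the long stripe is displaced, and the order of the two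
    colors on the axis, come from the signals on the two lines along which this
    tile is transparent.  For [k = 0] the representative of the axis is [k + 2]
    instead of [k - 1], which explains the test against [k == 0]. *)
Definition toeplitz (z : int * int) : orient :=
  let k := longdir z in let j := rb_axis k in
  let r := if front k z == (k == 0) then j else j + 3 in
  (r, if r == j then tint j z else ~~ tint j z).

Lemma front_double k z : front k (z + z) = front k z.
Proof. by rewrite /front alongD signal_double. Qed.

Lemma tint_double k z : tint k (z + z) = tint k z.
Proof. by rewrite /tint athwartD signal_double. Qed.

Lemma toeplitz_double z : toeplitz (z + z) = toeplitz z.
Proof. by rewrite /toeplitz longdir_double front_double tint_double. Qed.

Lemma alongN k z : along k (- z) = - along k z.
Proof.
have along0 : along k 0 = 0.
  by apply: (addrI (along k 0)); rewrite -alongD !addr0.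
by apply/eqP; rewrite -addr_eq0 -alongD addNr along0.
Qed.

Lemma athwartN k z : athwart k (- z) = - athwart k z.
Proof.
by rewrite /athwart alongN; congr (_, _); rewrite /= mulrN opprD.
Qed.

Lemma along_dir (k : 'Z_6) : along k (dir k) = (1, 0).
Proof. by elim/Z6_ind: k. Qed.

Lemma athwart_diag (k : 'Z_6) : athwart k (dir k + dir (k + 5)) = (1, 0).
Proof. by elim/Z6_ind: k. Qed.

(** The tile in a cell of odd class [c] is transparent in direction [c]; in the
    other two directions its mark depends on [c] alone. *)
Lemma front_odd k c w (z := w + w + dir c) :
  k \in [:: 0; 1; 2] -> c \in [:: 0; 1; 2] ->
  if c == k then front k (z - dir k) = front k z else
  front k z = (c == k + 2) || (c == k - 1) /\ front k (z - dir k) = ~~ front k z.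
Proof.
rewrite !inE /front alongD alongN along_dir /z !alongD => k2 c2.
case: eqP => [->|/eqP ck]; first by rewrite along_dir signal_pass.
by case/or3P: k2 ck => /eqP->; case/or3P: c2 => /eqP-> // _;
  apply: signal_class.
Qed.

Lemma tint_odd k c w (z := w + w + dir c) :
  k \in [:: 0; 1; 2] -> c \in [:: 0; 1; 2] ->
  if k == rb_axis c then tint k (z - (dir k + dir (k + 5))) = tint k z else
  tint k z = (c == k + 2) || (c == k - 1) /\
  tint k (z - (dir k + dir (k + 5))) = ~~ tint k z.
Proof.
rewrite !inE /tint athwartD athwartN athwart_diag /z !athwartD => k2 c2.
by case/or3P: k2 => /eqP->; case/or3P: c2 => /eqP->;
  (by apply: signal_pass) || (by apply: signal_class).
Qed.

(** The signals are the marks and the colors of the tiles, on the front side of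
    each line and, through the preceding cell, on the back side. *)
Lemma toeplitz_signals z k : k \in [:: 0; 1; 2] ->
  [/\ toward (toeplitz z).1 k = front k z,
      toward (toeplitz z).1 (k + 3) = ~~ front k (z - dir k),
      is_blue (shade (toeplitz z) k) = tint k z &
      is_blue (shade (toeplitz z) (k + 3)) = ~~ tint k (z - (dir k + dir (k + 5)))].
Proof.
(* Even cells reduce to their halves; the origin, fixed by halving, is computed. *)
move=> k2; have [n] := ubnP (`|z.1| + `|z.2|)%N; elim: n z => // n IH z zn.
have [->|z0] := eqVneq z 0.
  by move: k2; rewrite !inE => /or3P[] /eqP->; split; vm_compute.
have [[w zE]|[w [c c2 zE]]] := half_cases z.
- have /IH[] : (`|w.1| + `|w.2| < n)%N.
    move: zn z0; rewrite zE; case: w {zE} => x y.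
    rewrite -[_ == _]/((x + x == 0) && (y + y == 0)) /=; lia.
  rewrite zE toeplitz_double !front_double !tint_double => -> -> -> ->.
  rewrite /front /tint !alongD !athwartD !alongN !athwartN along_dir athwart_diag.
  by rewrite !signal_pred.
- have ck := longdir_odd w c2; rewrite -zE in ck.
  have := front_odd w k2 c2; have := tint_odd w k2 c2; rewrite -!zE.
  have : c == k -> front k z = front c z by move/eqP->.
  have : k == rb_axis c -> tint k z = tint (rb_axis c) z by move/eqP->.
  rewrite /toeplitz ck.
  move: (front k z) (front k (z - dir k)) (tint k z) (tint k (z - (dir k + dir (k + 5)))).
  move: (front c z) (tint (rb_axis c) z); clear - k2 c2 => b d A B C D.
  rewrite !inE in c2 k2; case/or3P: c2 => /eqP ->; case/or3P: k2 => /eqP ->;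
    case: b; case: d; case: A; case: B; case: C; case: D; vm_compute;
    (by move=> *; split) || (by intuition congruence).
Qed.

Lemma toeplitz_matching : matching toeplitz.
Proof.
have K (k : 'Z_6) : exists2 j : 'Z_6, j \in [:: 0; 1; 2] & k = j \/ k = j + 3.
  elim/Z6_ind: k; [exists 0 | exists 1 | exists 2 | exists 0 | exists 1 | exists 2] => //;
    (by left) || (by right; apply/eqP).
split=> z k; have [j j2] := K k.
- have st y : toward (toeplitz (y + dir j)).1 (j + 3) = ~~ toward (toeplitz y).1 j.
    have [-> _ _ _] := toeplitz_signals y j2; have [_ -> _ _] := toeplitz_signals (y + dir j) j2.
    by rewrite addrK.
  case=> ->; first exact: st.
  rewrite (_ : j + 3 + 3 = j); last by Z6 j.
  rewrite (dirN j); set y := z - _; have -> : z = y + dir j by rewrite subrK.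
  by rewrite st negbK.
- have sh y : is_blue (shade (toeplitz (y + (dir j + dir (j + 5)))) (j + 3))
      = ~~ is_blue (shade (toeplitz y) j).
    have [_ _ -> _] := toeplitz_signals y j2.
    have [_ _ _ ->] := toeplitz_signals (y + (dir j + dir (j + 5))) j2.
    by rewrite addrK.
  case=> -> /(congr1 is_blue); first by rewrite sh; case: is_blue.
  rewrite (_ : j + 3 + 3 = j); last by Z6 j.
  have -> : dir (j + 3) + dir (j + 3 + 5) = - (dir j + dir (j + 5)) by Z6 j.
  set y := z - _; have -> : z = y + (dir j + dir (j + 5)) by rewrite subrK.
  by rewrite sh; case: is_blue.
Qed.

(** * Hexagonal coordinates of the plane *)

Section Plane.
Variable R : realType.
Implicit Types (a b : R) (x y : plane R) (M : 'M[R]_2).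

(** From cos pi = -1 by the triple angle formula: c = cos (pi / 3) satisfies
    (c + 1) (2 c - 1) ^ 2 = 0. *)
Lemma cos_pi3 : cos (pi / 3) = 1 / 2 :> R.
Proof.
have c0 : 0 < cos (pi / 3 : R).
  apply: cos_gt0_pihalf; have := pi_gt0 R; lra.
have : cos (pi / 3 + pi / 3 + pi / 3 : R) = -1.
  by rewrite -cospi; congr cos; field.
rewrite !cosD sinD; have := cos2Dsin2 (pi / 3 : R).
move: (cos _) (sin _) c0 => c s c0 cs E.
have {}cs : s * s = 1 - c * c by lra.
have : (c + 1) * (2 * c - 1) ^+ 2 = 0.
  have -> : (c + 1) * (2 * c - 1) ^+ 2 = (c * c - s * s) * c
    - (s * c + c * s) * s + 1 + 3 * c * (s * s - (1 - c * c)) by ring.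
  by rewrite E cs; ring.
move/eqP; rewrite mulf_eq0 sqrf_eq0 => /orP[] /eqP; lra.
Qed.

Lemma sin_pi3 : sin (pi / 3) = Num.sqrt 3 / 2 :> R.
Proof.
have s0 : 0 < sin (pi / 3 : R).
  apply: sin_gt0_pihalf; have := pi_gt0 R; lra.
have := cos2Dsin2 (pi / 3 : R); rewrite cos_pi3 => E.
have r0 : 0 < Num.sqrt 3 / 2 :> R by rewrite divr_gt0 ?sqrtr_gt0.
apply/eqP; rewrite -(@eqrXn2 _ 2 _ _ _ (ltW s0) (ltW r0)) //.
by rewrite expr_div_n sqr_sqrtr //; apply/eqP; lra.
Qed.

(** The basis in which the hexagon and the lattice have integral data; the
    square of the norm becomes a ^ 2 + a b + b ^ 2. *)
Definition vec a b : plane R := a *: vertex R 0 + b *: vertex R 1.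

Lemma vertex0E : vertex R 0 = \row_j (if j == 0 then 1 else 0).
Proof. by apply/rowP => j; rewrite !mxE mul0r cos0 sin0. Qed.

Lemma vertex1E : vertex R 1 = \row_j (if j == 0 then 1 / 2 else Num.sqrt 3 / 2).
Proof.
apply/rowP => j; rewrite !mxE; have -> : (nat_of_ord (1 : 'Z_6))%:R * (pi / 3) = pi / 3 :> R.
  exact: mul1r.
by rewrite cos_pi3 sin_pi3.
Qed.

Lemma vec00 a b : vec a b 0 0 = a + b / 2.
Proof. by rewrite /vec vertex0E vertex1E !mxE /= mulr1 mul1r. Qed.

Lemma vec01 a b : vec a b 0 1 = b * (Num.sqrt 3 / 2).
Proof. by rewrite /vec vertex0E vertex1E !mxE /= mulr0 add0r. Qed.

Lemma planeP x y : x 0 0 = y 0 0 -> x 0 1 = y 0 1 -> x = y.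
Proof.
move=> E0 E1; apply/rowP => j; have : (j == 0) || (j == 1) by case: j => [[|[|]]].
by case/orP => /eqP->.
Qed.

Lemma sqrt3_gt0 : 0 < Num.sqrt 3 :> R. Proof. by rewrite sqrtr_gt0. Qed.

Lemma sqrt3E : Num.sqrt 3 * Num.sqrt 3 = 3 :> R.
Proof. by rewrite -expr2 sqr_sqrtr. Qed.

Lemma vecP x : exists a b, x = vec a b.
Proof.
have s0 := sqrt3_gt0.
exists (x 0 0 - x 0 1 / Num.sqrt 3), (2 * x 0 1 / Num.sqrt 3).
by apply: planeP; rewrite ?vec00 ?vec01; field; rewrite gt_eqF.
Qed.

Lemma vec_inj a b a' b' : vec a b = vec a' b' -> a = a' /\ b = b'.
Proof.
move=> E; have := congr1 (fun x : plane R => x 0 1) E.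
have := congr1 (fun x : plane R => x 0 0) E; rewrite !vec00 !vec01 => E0.
have s0 := sqrt3_gt0.
by move=> /mulIf Eb; have {}Eb := Eb _; rewrite {}Eb in E0 *; [lra | rewrite gt_eqF //; lra].
Qed.

Lemma vecD a b a' b' : vec a b + vec a' b' = vec (a + a') (b + b').
Proof. by rewrite /vec !scalerDl addrACA. Qed.

Lemma vecZ c a b : c *: vec a b = vec (c * a) (c * b).
Proof. by rewrite /vec scalerDr !scalerA. Qed.

Lemma vecN a b : - vec a b = vec (- a) (- b).
Proof. by rewrite -scaleN1r vecZ !mulN1r. Qed.

Lemma vecB a b a' b' : vec a b - vec a' b' = vec (a - a') (b - b').
Proof. by rewrite vecN vecD. Qed.

Definition ivec (u : int * int) : plane R := vec u.1%:~R u.2%:~R.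

Lemma ivecD u w : ivec (u + w) = ivec u + ivec w.
Proof. by rewrite /ivec vecD -!intrD. Qed.

Lemma ivec0 : ivec 0 = 0.
Proof. by apply: (addrI (ivec 0)); rewrite -ivecD !addr0. Qed.

Lemma ivecN u : ivec (- u) = - ivec u.
Proof. by rewrite /ivec vecN -!mulrNz. Qed.

Lemma ivec_inj : injective ivec.
Proof.
by case=> x y [x' y'] /vec_inj[/intr_inj /= -> /intr_inj /= ->].
Qed.

Lemma vertexE k : vertex R k = ivec (dir k).
Proof.
have rot (n : nat) a b : cos (n%:R * (pi / 3)) = a + b / 2 :> R ->
    sin (n%:R * (pi / 3)) = b * (Num.sqrt 3 / 2) :> R ->
    cos (n.+1%:R * (pi / 3)) = - b + (a + b) / 2 :> R /\
    sin (n.+1%:R * (pi / 3)) = (a + b) * (Num.sqrt 3 / 2) :> R.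
  move=> Ec Es; rewrite mulrSr mulrDl mul1r cosD sinD Ec Es cos_pi3 sin_pi3.
  split; last by field.
  rewrite [LHS](_ : _ = a / 2 + b / 4 - b / 4 * (Num.sqrt 3 * Num.sqrt 3)).
    by rewrite sqrt3E; field.
  by field.
have [c0 s0] : cos (0%:R * (pi / 3)) = 1 + 0 / 2 :> R /\
    sin (0%:R * (pi / 3)) = 0 * (Num.sqrt 3 / 2) :> R.
  by rewrite mul0r cos0 sin0; split; ring.
have [c1 s1] := rot _ _ _ c0 s0; have [c2 s2] := rot _ _ _ c1 s1.
have [c3 s3] := rot _ _ _ c2 s2; have [c4 s4] := rot _ _ _ c3 s3.
have [c5 s5] := rot _ _ _ c4 s4.
by elim/Z6_ind: k; apply: planeP; rewrite /ivec ?vec00 ?vec01 !mxE /=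
  ?c0 ?c1 ?c2 ?c3 ?c4 ?c5 ?s0 ?s1 ?s2 ?s3 ?s4 ?s5; rewrite ?mulrNz; ring.
Qed.

End Plane.

(** * The hexagon and its symmetries *)

Section Hexagon.
Variable R : realType.
Implicit Types (a b : R) (x y : plane R) (M : 'M[R]_2) (g : placement R).

Definition sqnorm x : R := x 0 0 ^+ 2 + x 0 1 ^+ 2.

Lemma sqnormE x : sqnorm x = (x *m x^T) 0 0.
Proof.
rewrite mxE big_ord_recl big_ord1 !mxE /sqnorm !expr2.
by congr (_ * _ + _ * _); congr (x _ _); apply: val_inj.
Qed.

Lemma sqnorm_vec a b : sqnorm (vec a b) = a ^+ 2 + a * b + b ^+ 2.
Proof.
rewrite /sqnorm vec00 vec01 [LHS](_ : _ = a ^+ 2 + a * b + b ^+ 2 / 4 +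
  b ^+ 2 / 4 * (Num.sqrt 3 * Num.sqrt 3)); last by field.
by rewrite sqrt3E; field.
Qed.

Lemma sqnorm_isometry M x : M *m M^T = 1%:M -> sqnorm (x *m M) = sqnorm x.
Proof. by move=> ME; rewrite !sqnormE trmx_mul mulmxA -(mulmxA x) ME mulmx1. Qed.

(** The hexagon is cut out by three pairs of parallel lines. *)
Definition inhex a b := [&& -1 <= a <= 1, -1 <= b <= 1 & -1 <= a + b <= 1].

Lemma sum_Z6 (V : nmodType) (F : 'Z_6 -> V) :
  \sum_k F k = F 0 + F 1 + F 2 + F 3 + F 4 + F 5.
Proof.
rewrite !big_ord_recl big_ord0 addr0 !addrA.
by do !congr (_ + _); congr F; apply: val_inj.
Qed.

Lemma sum_delta (V : nmodType) (k : 'Z_6) (F : 'Z_6 -> V) :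
  \sum_j F j *+ (j == k) = F k.
Proof.
by rewrite (bigD1 k) //= eqxx big1 ?addr0 // => j /negPf->.
Qed.

Lemma hexagonE a b : hexagon (vec a b) <-> inhex a b.
Proof.
split=> [[w [w0 w1]]|].
  rewrite sum_Z6 !vertexE /ivec !vecZ !vecD => /vec_inj[-> ->].
  rewrite sum_Z6 in w1; rewrite /inhex /dir /=.
  move: (w0 0) (w0 1) (w0 2) (w0 3) (w0 4) (w0 5) w1.
  move: (w 0) (w 1) (w 2) (w 3) (w 4) (w 5) => x0 x1 x2 x3 x4 x5 *; lra.
(* A point satisfying the inequalities lies in one of the six triangles spanned
   by the center and a side. *)
suff sector k c e : 0 <= c -> 0 <= e -> c + e <= 1 ->
    hexagon (c *: vertex R k + e *: vertex R (k + 1)).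
  rewrite /inhex => h.
  have go k c e : 0 <= c -> 0 <= e -> c + e <= 1 -> 
      vec a b = c *: vertex R k + e *: vertex R (k + 1) -> hexagon (vec a b).
    by move=> c0 e0 ce ->; exact: sector.
  have [a0|a0] := leP 0 a; have [b0|b0] := leP 0 b; have [c0|c0] := leP 0 (a + b).
  - apply: (go 0 a b); [lra|lra|lra|rewrite !vertexE /ivec !vecZ vecD].
    by congr vec; rewrite /=; ring.
  - exfalso; lra.
  - apply: (go 5 (- b) (a + b)); [lra|lra|lra|rewrite !vertexE /ivec !vecZ vecD].
    by congr vec; rewrite /=; ring.
  - apply: (go 4 (- a - b) a); [lra|lra|lra|rewrite !vertexE /ivec !vecZ vecD].
    by congr vec; rewrite /=; ring.
  - apply: (go 1 (a + b) (- a)); [lra|lra|lra|rewrite !vertexE /ivec !vecZ vecD].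
    by congr vec; rewrite /=; ring.
  - apply: (go 2 b (- a - b)); [lra|lra|lra|rewrite !vertexE /ivec !vecZ vecD].
    by congr vec; rewrite /=; ring.
  - exfalso; lra.
  - apply: (go 3 (- a) (- b)); [lra|lra|lra|rewrite !vertexE /ivec !vecZ vecD].
    by congr vec; rewrite /=; ring.
move=> c0 e0 ce.
(* The center, as the mean of the vertices, absorbs the remaining weight. *)
exists (fun j => (1 - c - e) / 6 + (c *+ (j == k) + e *+ (j == k + 1))); split.
- by move=> j; rewrite !addr_ge0 ?mulrn_wge0 ?divr_ge0 //; lra.
- by rewrite big_split /= sum_Z6 big_split /= !(sum_delta _ (fun=> _)); field.
- rewrite (eq_bigr (fun j => ((1 - c - e) / 6) *: vertex R j +
      ((c *: vertex R j) *+ (j == k) + (e *: vertex R j) *+ (j == k + 1)))).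
    rewrite big_split /= -scaler_sumr big_split /= !(sum_delta _ (fun j => _ *: vertex R j)).
    rewrite [\sum_j _](_ : _ = 0) ?scaler0 ?add0r //.
    by rewrite sum_Z6 !vertexE -!ivecD (_ : _ + dir 5 = 0) ?ivec0.
  by move=> j _; rewrite !scalerDl !scalerMnl.
Qed.

(** The matrix that carries vertex 0 to [p] and vertex 1 to [q]. *)
Definition frame (p q : plane R) : 'M[R]_2 :=
  \matrix_(i, j) if i == 0 then p 0 j else (2 * q 0 j - p 0 j) / Num.sqrt 3.

Lemma mul_frame p q a b : vec a b *m frame p q = a *: p + b *: q.
Proof.
have s0 := sqrt3_gt0 R.
apply/rowP => j; rewrite mxE big_ord_recl big_ord1.
have -> : lift ord0 ord0 = 1 :> 'I_2 by apply: val_inj.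
by rewrite vec00 vec01 !mxE /=; field; rewrite gt_eqF.
Qed.

Lemma eq_frame M M' : vertex R 0 *m M = vertex R 0 *m M' ->
  vertex R 1 *m M = vertex R 1 *m M' -> M = M'.
Proof.
move=> E0 E1; have E x : x *m M = x *m M'.
  have [a [b ->]] := vecP x; by rewrite /vec !mulmxDl -!scalemxAl E0 E1.
by apply/row_matrixP => i; rewrite !rowE.
Qed.

Definition dihedral (t : orient) : 'M[R]_2 :=
  frame (vertex R (turn t 0)) (vertex R (turn t 1)).

Lemma vertex_dihedral t k : vertex R k *m dihedral t = vertex R (turn t k).
Proof.
rewrite vertexE mul_frame !vertexE /ivec !vecZ vecD -!intrM -!intrD.
by case: t => r []; elim/Z6_ind: r; elim/Z6_ind: k.
Qed.

Lemma turn_comp t t' : exists u, forall k, turn t (turn t' k) = turn u k.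
Proof.
exists (turn t t'.1, t.2 (+) t'.2) => k; case: t t' => r [] [r' []];
  rewrite /turn /=; ring.
Qed.

Lemma dihedral_comp t t' : exists u, dihedral t *m dihedral t' = dihedral u.
Proof.
have [u E] := turn_comp t' t; exists u.
by apply: eq_frame; rewrite mulmxA !vertex_dihedral E.
Qed.

Lemma dihedral1 : dihedral (0, false) = 1%:M.
Proof. by apply: eq_frame; rewrite mulmx1 vertex_dihedral. Qed.

Lemma ord2_lift : lift ord0 ord0 = 1 :> 'I_2. Proof. exact: val_inj. Qed.

Lemma frame_isometry p q :
  sqnorm p = 1 -> sqnorm q = 1 -> p 0 0 * q 0 0 + p 0 1 * q 0 1 = 1 / 2 ->
  frame p q *m (frame p q)^T = 1%:M.
Proof.
rewrite /sqnorm => pp qq pq; have s0 := sqrt3_gt0 R.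
have z0 : (0 == 0 :> 'I_2) = true by [].
have z1 : (1 == 0 :> 'I_2) = false by [].
have e01 : (0 == 1 :> 'I_2) = false by [].
have I2 (i : 'I_2) : (i == 0) || (i == 1) by case: i => [[|[|]]].
apply/matrixP => i j; rewrite mxE big_ord_recl big_ord1 ord2_lift !mxE.
case/orP: (I2 i) => /eqP->; case/orP: (I2 j) => /eqP->;
  rewrite ?z0 ?z1 ?eqxx ?e01 /=.
- by rewrite -!expr2.
- rewrite !mulrA -mulrDl; apply/eqP; rewrite mulf_eq0; apply/orP; left; apply/eqP; lra.
- rewrite ![_ / _ * _]mulrAC -mulrDl; apply/eqP; rewrite mulf_eq0; apply/orP; left; apply/eqP; lra.
- rewrite !mulf_div -mulrDl sqrt3E -[RHS](@divff _ 3) //; congr (_ / _); lra.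
Qed.

Lemma det_frame p q :
  \det (frame p q) = (p 0 0 * q 0 1 - p 0 1 * q 0 0) * (2 / Num.sqrt 3).
Proof.
have s0 := sqrt3_gt0 R.
rewrite (expand_det_row _ 0) big_ord_recl big_ord1 ord2_lift /cofactor !det_mx11 !mxE /=.
have -> : lift 0 0 = 1 :> 'I_2 by apply: val_inj.
have -> : lift 1 0 = 0 :> 'I_2 by apply: val_inj.
by rewrite expr0 expr1 /=; field; rewrite gt_eqF.
Qed.

Lemma turn01 t : (turn t 1 = turn t 0 + 1 /\ t.2 = false) \/ (turn t 0 = turn t 1 + 1 /\ t.2).
Proof. by case: t => r []; [right|left]; rewrite /turn /=; split=> //; ring. Qed.

Lemma dihedral_isometry t : dihedral t *m (dihedral t)^T = 1%:M.
Proof.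
apply: frame_isometry.
- rewrite vertexE sqnorm_vec; elim/Z6_ind: (turn t 0); rewrite /dir /=; ring.
- rewrite vertexE sqnorm_vec; elim/Z6_ind: (turn t 1); rewrite /dir /=; ring.
rewrite !vertexE /ivec !vec00 !vec01.
have [[-> _]|[-> _]] := turn01 t.
  have s := sqrt3E R; elim/Z6_ind: (turn t 0); rewrite /dir /=; lra.
  have s := sqrt3E R; elim/Z6_ind: (turn t 1); rewrite /dir /=; lra.
Qed.

Lemma det_dihedral t : \det (dihedral t) = (-1) ^+ t.2.
Proof.
have s0 := sqrt3_gt0 R.
rewrite det_frame !vertexE /ivec !vec00 !vec01.
have [[-> ->]|[-> ->]] := turn01 t; rewrite ?expr0 ?expr1.
  by elim/Z6_ind: (turn t 0); rewrite /dir /=; field; rewrite gt_eqF.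
by elim/Z6_ind: (turn t 1); rewrite /dir /=; field; rewrite gt_eqF.
Qed.
End Hexagon.

(** * Placed tiles and their interiors *)

(* The shift of a placement is the center of its tile. *)
Notation ctr := Defs.shift.

Section Tiles.
Variable R : realType.
Implicit Types (a b : R) (x y : plane R) (g h : placement R).

Lemma placeD g x y : place g (x + y) = place g x + y *m lin g.
Proof. by rewrite /place mulmxDl addrAC. Qed.

Lemma placeB g x y : place g x - place g y = (x - y) *m lin g.
Proof. by rewrite /place mulmxBl opprD addrACA subrr addr0. Qed.

Lemma place_dist g x y : is_isometry g ->
  sqnorm (place g x - place g y) = sqnorm (x - y).
Proof. by move=> gi; rewrite placeB sqnorm_isometry. Qed.

Lemma place_surj g y : is_isometry g -> exists a b, y = place g (vec a b).
Proof.
move=> gi; have [a [b E]] := vecP ((y - ctr g) *m (lin g)^T).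
exists a, b; rewrite /place -E -mulmxA (mulmx1C gi) mulmx1; exact: esym (subrK _ _).
Qed.

Lemma place_inj g : is_isometry g -> injective (place g).
Proof.
move=> gi x y /addIr E; have := congr1 (fun z => z *m (lin g)^T) E.
by rewrite -!mulmxA gi !mulmx1.
Qed.

Lemma place0 g : place g 0 = ctr g.
Proof. by rewrite /place mul0mx add0r. Qed.

Lemma tileE g a b : is_isometry g -> tile g (place g (vec a b)) <-> inhex a b.
Proof.
move=> gi; split=> [[x hx /(place_inj gi) E]|h]; first by apply/hexagonE; rewrite -E.
by exists (vec a b) => //; apply/hexagonE.
Qed.

Definition inner a b := [&& -1 < a < 1, -1 < b < 1 & -1 < a + b < 1].

Definition affine (p q r : R) y := p * y 0 0 + q * y 0 1 + r.

Lemma affine_near p q r x (z z' : R) : z < affine p q r x < z' ->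
  \forall y \near x, z < affine p q r y < z'.
Proof.
move=> /andP[zx xz].
have c : (affine p q r : plane R -> R) @ nbhs x --> affine p q r x.
  have c0 := @coord_continuous R 1 2 0 0 x; have c1 := @coord_continuous R 1 2 0 1 x.
  exact: cvgD (cvgD (cvgM (cvg_cst p) c0) (cvgM (cvg_cst q) c1)) (cvg_cst r).
near=> y; apply/andP; split; near: y.
- exact: (cvgr_gt (affine p q r x) c z zx).
- exact: (cvgr_lt (affine p q r x) c z' xz).
Unshelve. all: by end_near.
Qed.

Lemma place_coordinates g : is_isometry g -> exists p q r p' q' r' : R,
  forall y, y = place g (vec (affine p q r y) (affine p' q' r' y)).
Proof.
move=> gi; have [a [b E]] := place_surj 0 gi.
have [a0 [b0 E0]] := place_surj (delta_mx 0 0) gi.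
have [a1 [b1 E1]] := place_surj (delta_mx 0 1) gi.
exists (a0 - a), (a1 - a), a, (b0 - b), (b1 - b), b => y.
transitivity (place g (vec a b) + y 0 0 *: (place g (vec a0 b0) - place g (vec a b))
    + y 0 1 *: (place g (vec a1 b1) - place g (vec a b))).
  by rewrite -E -E0 -E1; apply: planeP; rewrite !mxE /=; ring.
by rewrite !placeB !scalemxAl -!placeD !vecB !vecZ !vecD /affine;
  congr (place g (vec _ _)); ring.
Qed.

Lemma inner_interior g a b : is_isometry g -> inner a b ->
  interior (tile g) (place g (vec a b)).
Proof.
move=> gi hab; have [p [q [r [p' [q' [r' E]]]]]] := place_coordinates gi.
set x := place g (vec a b).
have := E x; rewrite {1}/x => /(place_inj gi)/vec_inj[xa xb].
have addE y : affine p q r y + affine p' q' r' y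
    = affine (p + p') (q + q') (r + r') y by rewrite /affine; ring.
have xab := addE x; rewrite -xa -xb in xab.
case/and3P: hab => ha hb hab; rewrite xa in ha; rewrite xb in hb; rewrite xab in hab.
rewrite /interior /=; near=> y; rewrite (E y); apply/tileE => //.
suff /and3P[/andP[? ?] /andP[? ?] /andP[? ?]] :
    inner (affine p q r y) (affine p' q' r' y).
  by apply/and3P; split; apply/andP; split; apply: ltW.
apply/and3P; split; rewrite ?addE; near: y; exact: affine_near.
Unshelve. all: by end_near.
Qed.

Lemma interior_ray (A : set (plane R)) x u : interior A x ->
  \forall e \near 0^'+, A (x + e *: u).
Proof.
move=> Ax; have c : (fun e : R => x + e *: u) @ (0 : R)^'+ --> x.
  rewrite -[X in _ --> X]addr0 -[X in _ + X](scale0r u).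
  apply: cvg_at_right_filter.
  exact: cvgD (cvg_cst x) (@scalel_continuous R _ u 0).
exact: c.
Qed.

(** An interior point stays in the tile when moved outward from the center. *)
Lemma interior_inner g a b : is_isometry g ->
  interior (tile g) (place g (vec a b)) -> inner a b.
Proof.
move=> gi /(interior_ray (vec a b *m lin g)) nE.
have [e [+ e0]] := filter_ex (filterI nE (nbhs_right_gt 0)).
rewrite /= scalemxAl -placeD vecZ vecD => /(tileE _ _ gi).
rewrite /inhex /inner; nra.
Qed.

End Tiles.

(** * Local finiteness of a tiling *)

Section LocalFiniteness.
Variable R : realType.
Implicit Types (a b : R) (x y : plane R) (g h : placement R) (T : set (placement R)).

(** The inscribed circle has radius sqrt 3 / 2. *)
Lemma inner_of_norm a b : sqnorm (vec a b) < 3 / 4 -> inner a b.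
Proof.
rewrite sqnorm_vec /inner => H.
have Ha : a ^+ 2 < 1 by have := sqr_ge0 (2 * b + a); nra.
have Hb : b ^+ 2 < 1 by have := sqr_ge0 (2 * a + b); nra.
have Hc : (a + b) ^+ 2 < 1 by have := sqr_ge0 (a - b); nra.
have S (x : R) : x ^+ 2 < 1 -> -1 < x < 1.
  by rewrite -ltr_norml -[X in _ < X -> _](expr1n R 2) -real_normK ?num_real // ltr_pXn2r // nnegrE.
by rewrite !S.
Qed.

Lemma inhex_norm a b : inhex a b -> sqnorm (vec a b) <= 1.
Proof.
rewrite sqnorm_vec /inhex => H.
have [a0|a0] := leP 0 a; have [b0|b0] := leP 0 b; have [c0|c0] := leP 0 (a + b); nra.
Qed.

(** The circumscribed circle meets the hexagon in the vertices. *)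
Lemma inhex_vertex a b : inhex a b -> sqnorm (vec a b) = 1 ->
  exists k, vec a b = vertex R k.
Proof.
rewrite sqnorm_vec /inhex => H E.
suff [k [-> ->]] : exists k, a = (dir k).1%:~R /\ b = (dir k).2%:~R.
  by exists k; rewrite vertexE.
have zero (u w : R) : u * w = 0 -> u = 0 \/ w = 0.
  by move/eqP; rewrite mulf_eq0 => /orP[] /eqP; [left|right].
have [a0|a0] := leP 0 a; have [b0|b0] := leP 0 b; have [c0|c0] := leP 0 (a + b).
- have ab : a * b = 0 by nra.
  have c1 : a + b = 1 by nra.
  by case: (zero _ _ ab) => z; [exists 1 | exists 0]; rewrite /dir /=; split; lra.
- lra.
- have bc : b * (a + b) = 0 by nra.
  have a1 : a = 1 by nra.
  by case: (zero _ _ bc) => z; [lra | exists 5]; rewrite /dir /=; split; lra.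
- have ac : a * (a + b) = 0 by nra.
  have b1 : b = -1 by nra.
  by case: (zero _ _ ac) => z; [exists 4 | lra]; rewrite /dir /=; split; lra.
- have ac : a * (a + b) = 0 by nra.
  have b1 : b = 1 by nra.
  by case: (zero _ _ ac) => z; [lra | exists 2]; rewrite /dir /=; split; lra.
- have bc : b * (a + b) = 0 by nra.
  have a1 : a = -1 by nra.
  by case: (zero _ _ bc) => z; [exists 3 | lra]; rewrite /dir /=; split; lra.
- lra.
- by exfalso; nra.
Qed.

Lemma affine_near_right (u w z : R) : z < u -> \forall e \near 0^'+, z < u + e * w.
Proof.
move=> zu; have c : (fun e : R => u + e * w) @ (0 : R)^'+ --> u.
  rewrite -[X in _ --> X]addr0 -[X in _ + X](mul0r w).
  apply: cvg_at_right_filter.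
  exact: cvgD (cvg_cst u) (@scalel_continuous R R^o w 0).
exact: (cvgr_gt u c).
Qed.

Lemma tile_complement_ray g x y : is_isometry g -> ~ tile g x ->
  \forall e \near (0 : R)^'+, ~ tile g (x + e *: y).
Proof.
move=> gi; have [a [b ->]] := place_surj x gi.
have [c [d E]] := vecP (y *m (lin g)^T).
have {}E e : place g (vec a b) + e *: y = place g (vec (a + e * c) (b + e * d)).
  by rewrite -vecD -vecZ placeD -E -scalemxAl -mulmxA (mulmx1C gi) mulmx1.
move=> nab; have {}nab : ~ inhex a b by move/(tileE _ _ gi).
suff : \forall e \near (0 : R)^'+, ~ inhex (a + e * c) (b + e * d).
  by apply: filterS => e ne; rewrite E => /(tileE _ _ gi).
have : 1 < a \/ 1 < - a \/ 1 < b \/ 1 < - b \/ 1 < a + b \/ 1 < - a - b.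
  apply: contrapT => /not_orP[] /negP + /not_orP[] /negP + /not_orP[] /negP +
    /not_orP[] /negP + /not_orP[] /negP + /negP.
  by rewrite -!leNgt => *; apply: nab; rewrite /inhex; lra.
case=> [H|[H|[H|[H|[H|H]]]]].
- by apply: filterS (affine_near_right c H) => e He; rewrite /inhex => K; lra.
- by apply: filterS (affine_near_right (- c) H) => e He; rewrite /inhex => K; lra.
- by apply: filterS (affine_near_right d H) => e He; rewrite /inhex => K; lra.
- by apply: filterS (affine_near_right (- d) H) => e He; rewrite /inhex => K; lra.
- by apply: filterS (affine_near_right (c + d) H) => e He; rewrite /inhex => K; lra.
- by apply: filterS (affine_near_right (- c - d) H) => e He; rewrite /inhex => K; lra.
Qed.

Lemma tile_norm g x : is_isometry g -> tile g x -> sqnorm (ctr g - x) <= 1.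
Proof.
move=> gi gx; have [a [b E]] := place_surj x gi; rewrite E in gx *.
rewrite -place0 place_dist // sub0r vecN; have /(inhex_norm) := (tileE _ _ gi).1 gx.
by rewrite !sqnorm_vec; nra.
Qed.

Lemma tile_norm1 g x : is_isometry g -> tile g x -> sqnorm (ctr g - x) = 1 ->
  exists k, tile_vertex g k = x.
Proof.
move=> gi gx; have [a [b E]] := place_surj x gi; rewrite E in gx *.
rewrite -place0 place_dist // sub0r vecN => N1.
have [] := inhex_vertex ((tileE _ _ gi).1 gx); last by move=> k ->; exists k.
by rewrite -N1 !sqnorm_vec; ring.
Qed.

Lemma shift_ord (n : int) : -2 <= n -> n < 3 -> exists i : 'I_5, n + 2 = i%:Z.
Proof.
move=> l r; have nlt : (absz (n + 2)%R < 5)%N by lia.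
by exists (Ordinal nlt); rewrite /=; lia.
Qed.

Section Tiling.
Variable T : set (placement R).
Hypothesis Ttil : is_tiling T.

Let Tiso g : T g -> is_isometry g. Proof. by case: Ttil => + _ _; apply. Qed.

Lemma tiling_cover x : exists2 g, T g & tile g x.
Proof.
case: Ttil => _ cov _; have : setT x by [].
by rewrite -cov => -[g]; exists g.
Qed.

(** The point [x] of [h] can be moved toward the center of [h] into the interior
    of [h] without leaving the interior of [g]. *)
Lemma tiling_disjoint g h x : T g -> T h ->
  interior (tile g) x -> tile h x -> g = h.
Proof.
move=> Tg Th gx hx; have hi := Tiso Th.
have [a [b E]] := place_surj x hi; rewrite E in gx hx.
have hab := (tileE _ _ hi).1 hx.
have nE := interior_ray (- (vec a b *m lin h)) (nbhs_interior gx).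
have [e []] := filter_ex (filterI nE
  (filterI (nbhs_right_gt 0) (nbhs_right_lt (ltr01 : 0 < 1 :> R)))).
rewrite /= scalerN scalemxAl -mulNmx -placeD vecZ vecN vecD => ge [e0 e1].
case: Ttil => _ _; apply => //; exists (place h (vec (a - e * a) (b - e * b))).
split => //; apply: inner_interior => //.
move: hab; rewrite /inhex /inner; nra.
Qed.

(** Otherwise the midpoint of the centers is interior to both inscribed disks. *)
Lemma centers_apart g h : T g -> T h -> sqnorm (ctr g - ctr h) < 3 -> g = h.
Proof.
move=> Tg Th gh; have gi := Tiso Tg; have hi := Tiso Th.
pose m := 2^-1 *: (ctr g + ctr h).
have half k k' : m - ctr k = 2^-1 *: (ctr k' - ctr k) ->
    is_isometry k -> sqnorm (ctr k' - ctr k) < 3 -> interior (tile k) m.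
  move=> E ki kk; have [a [b mE]] := place_surj m ki.
  rewrite mE; apply: inner_interior => //; apply: inner_of_norm.
  rewrite -[vec a b]subr0 -(place_dist _ _ ki) -mE place0 E.
  by move: kk; rewrite /sqnorm !mxE; lra.
have gm : interior (tile g) m.
  apply: (half g h) => //.
    by apply: planeP; rewrite !mxE; lra.
  by move: gh; rewrite /sqnorm !mxE; lra.
have hm : interior (tile h) m.
  apply: (half h g) => //.
  by apply: planeP; rewrite !mxE; lra.
by apply: (tiling_disjoint Tg Th gm); exact: interior_subset hm.
Qed.

(** Local finiteness: the tiles met by a short segment issuing from [x] contain
    [x].  The centers of the tiles that come close to [x] lie in finitely many
    unit squares, each square contains at most one center, and a tile avoiding
    [x] is avoided by a short enough segment. *)
Lemma tiling_locally x y :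
  \forall e \near (0 : R)^'+, forall g, T g -> tile g (x + e *: y) -> tile g x.
Proof.
(* The offset 2 makes the integral parts of the coordinates range over 0..4. *)
pose cell g (i : 'I_5 * 'I_5) :=
  Num.floor ((ctr g - x) 0 0) + 2 = i.1%:Z /\
  Num.floor ((ctr g - x) 0 1) + 2 = i.2%:Z.
have cell_near i : \forall e \near (0 : R)^'+,
    forall g, T g -> cell g i -> tile g (x + e *: y) -> tile g x.
  have [[g [Tg gi]]|none] := pselect (exists g, T g /\ cell g i); last first.
    by near=> e => g Tg gi; case: none; exists g.
  have uniq h : T h -> cell h i -> h = g.
    move=> Th [h0 h1]; case: gi => g0 g1; apply: centers_apart => //.
    have near_floor (u w : R) : Num.floor u = Num.floor w -> (u - w) ^+ 2 < 1.
      have := floor_itv u; have := floor_itv w.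
      by move=> + + E; rewrite E intrD; nra.
    have F0 : Num.floor ((ctr h - x) 0 0) = Num.floor ((ctr g - x) 0 0) by lia.
    have F1 : Num.floor ((ctr h - x) 0 1) = Num.floor ((ctr g - x) 0 1) by lia.
    have := near_floor _ _ F0; have := near_floor _ _ F1.
    by rewrite /sqnorm !mxE; nra.
  have [gx|gx] := pselect (tile g x).
    by near=> e => h Th hi _; rewrite (uniq h).
  apply: filterS (tile_complement_ray y (Tiso Tg) gx) => e ne h Th hi he.
  by case: ne; rewrite -(uniq h).
have all_cells : \forall e \near (0 : R)^'+, forall i g, T g -> cell g i ->
    tile g (x + e *: y) -> tile g x.
  exact: filter_forall.
have small j : \forall e \near (0 : R)^'+, -1 < e * y 0 j < 1.
  have L : \forall e \near (0 : R)^'+, -1 < 0 + e * y 0 j by apply: affine_near_right; lra.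
  have L' : \forall e \near (0 : R)^'+, -1 < 0 + e * - y 0 j by apply: affine_near_right; lra.
  by apply: filterS (filterI L L') => e /= []; lra.
apply: filterS (filterI all_cells (filterI (small 0) (small 1))) => e [H [s0 s1]] g Tg ge.
have gi := Tiso Tg.
have D := tile_norm gi ge.
have [d0 d1] : -2 <= (ctr g - x) 0 0 < 3 /\ -2 <= (ctr g - x) 0 1 < 3.
  have sq (u w : R) : u ^+ 2 + w ^+ 2 <= 1 -> -1 <= u <= 1 /\ -1 <= w <= 1.
    by move=> uw; split; have := sqr_ge0 u; have := sqr_ge0 w; nra.
  by move: (sq _ _ D); rewrite !mxE; move: s0 s1; lra.
have F (u : R) : -2 <= u < 3 -> exists i : 'I_5, Num.floor u + 2 = i%:Z.
  move=> hu; have l : (-2 <= Num.floor u)%R by rewrite floor_ge_int; lra.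
  have r : (Num.floor u < 3)%R by rewrite floor_lt_int; lra.
  exact: shift_ord.
have [i0 E0] := F _ d0; have [i1 E1] := F _ d1.
exact: (H (i0, i1)) ge.
Unshelve. all: by end_near.
Qed.
End Tiling.
End LocalFiniteness.

(** * The tiles around a vertex *)

Section VertexStar.
Variable R : realType.
Implicit Types (a b : R) (x y : plane R) (g h : placement R) (T : set (placement R)).

(** Three centers at distance at most 1 from a common point and pairwise at
    least sqrt 3 apart form an equilateral triangle around it, because
    3 (|u|^2 + |v|^2 + |w|^2) = |u+v+w|^2 + |u-v|^2 + |v-w|^2 + |w-u|^2. *)
Lemma three_centers (u v w : plane R) :
  sqnorm u <= 1 -> sqnorm v <= 1 -> sqnorm w <= 1 ->
  3 <= sqnorm (u - v) -> 3 <= sqnorm (v - w) -> 3 <= sqnorm (w - u) ->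
  [/\ u + v + w = 0, sqnorm v = 1 & sqnorm w = 1].
Proof.
rewrite /sqnorm !mxE => u1 v1 w1 uv vw wu.
have q0 := sqr_ge0 (u 0 0 + v 0 0 + w 0 0).
have q1 := sqr_ge0 (u 0 1 + v 0 1 + w 0 1).
have S : (u 0 0 + v 0 0 + w 0 0) ^+ 2 + (u 0 1 + v 0 1 + w 0 1) ^+ 2 <= 0 by nra.
have S0 : u 0 0 + v 0 0 + w 0 0 = 0 by apply/eqP; rewrite -sqrf_eq0; apply/eqP; lra.
have S1 : u 0 1 + v 0 1 + w 0 1 = 0 by apply/eqP; rewrite -sqrf_eq0; apply/eqP; lra.
by split; [apply: planeP; rewrite !mxE | lra | lra].
Qed.

(** An isometry fixing the center that carries a vertex of the hexagon to a
    vertex is one of its twelve symmetries: the next vertex goes to one of the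
    two neighbors of the image.  It is vertex 4 that matters because vertex 0
    of a cell lies in that direction from the center of the cell across the side
    from vertex 0 to vertex 1. *)
Lemma dihedral_align (M : 'M[R]_2) j : M *m M^T = 1%:M ->
  vertex R j *m M = vertex R 4 -> exists t, M = dihedral R t.
Proof.
move=> Mi jM; have [a [b E]] := vecP (vertex R (j + 1) *m M).
have n1 : sqnorm (vertex R (j + 1) *m M) = 1.
  by rewrite sqnorm_isometry // vertexE sqnorm_vec; elim/Z6_ind: j {jM E}; rewrite /dir /=; ring.
have n2 : sqnorm (vertex R (j + 1) *m M - vertex R j *m M) = 1.
  rewrite -mulmxBl sqnorm_isometry // !vertexE -ivecN -ivecD sqnorm_vec.
  by elim/Z6_ind: j {jM E n1}; rewrite /dir /=; ring.
rewrite jM E vertexE /ivec vecB !sqnorm_vec /dir /= in n1 n2.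
have aE : a = -1 - 2 * b by lra.
have : b * (b + 1) = 0 by rewrite aE in n1; lra.
have fin t : turn t j = 4 -> vec a b = vertex R (turn t (j + 1)) -> M = dihedral R t.
  move=> t0 t1.
  have A0 : vertex R j *m M = vertex R j *m dihedral R t.
    by rewrite vertex_dihedral t0.
  have A1 : vertex R (j + 1) *m M = vertex R (j + 1) *m dihedral R t.
    by rewrite vertex_dihedral E t1.
  have step k : vertex R k *m M = vertex R k *m dihedral R t ->
      vertex R (k + 1) *m M = vertex R (k + 1) *m dihedral R t ->
      vertex R (k + 1 + 1) *m M = vertex R (k + 1 + 1) *m dihedral R t.
    have -> : vertex R (k + 1 + 1) = vertex R (k + 1) - vertex R k.
      by rewrite !vertexE -ivecN -ivecD; congr (ivec _ _); Z6 k.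
    by rewrite !mulmxBl => -> ->.
  have all (n : nat) : vertex R (j + n%:R) *m M = vertex R (j + n%:R) *m dihedral R t /\
      vertex R (j + n%:R + 1) *m M = vertex R (j + n%:R + 1) *m dihedral R t.
    elim: n => [|n [I0 I1]]; first by rewrite addr0.
    by rewrite mulrSr addrA; split=> //; exact: step.
  have all' k : vertex R k *m M = vertex R k *m dihedral R t.
    have [n <-] : exists n : nat, j + n%:R = k.
      by exists (nat_of_ord (k - j)); rewrite natr_Zp addrC subrK.
    exact: (all n).1.
  exact: eq_frame.
move/eqP; rewrite mulf_eq0 => /orP[] /eqP bE.
- exists (4 + j, true); apply: fin; rewrite /turn /= ?addrK //.
  rewrite (_ : 4 + j - (j + 1) = 3); last by Z6 j.
  by rewrite vertexE /ivec /dir /=; congr vec; lra.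
- exists (4 - j, false); apply: fin; rewrite /turn /= ?subrK //.
  rewrite (_ : 4 - j + (j + 1) = 5); last by Z6 j.
  by rewrite vertexE /ivec /dir /=; congr vec; lra.
Qed.

Section Tiling.
Variable T : set (placement R).
Hypothesis Ttil : is_tiling T.

Let Tiso g : T g -> is_isometry g. Proof. by case: Ttil => + _ _; apply. Qed.

(** Let [v] be the vertex of the tile [g] named by the placement [G] of the same
    hexagon.  The tiles covering two points near [v], almost on the sides of [g]
    issuing from [v] but outside [g], contain [v]; they are distinct, since
    by convexity a tile containing both points would overlap [g].  With [g] they
    make three tiles at [v], so that their centers are the reflections of the
    center of [g] in those two sides. *)
Lemma tiling_star G g : T g -> is_isometry G -> tile G = tile g -> ctr G = ctr g ->
  exists2 h, T h & ctr h = place G (vec 1 1) /\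
    exists k, tile_vertex h k = place G (vec 1 0).
Proof.
move=> Tg Gi Gg cGg; set v := place G (vec 1 0).
pose y1 : plane R := vec (-1) (3 / 2) *m lin G.
pose y2 : plane R := vec (1 / 2) (- 3 / 2) *m lin G.
have E1 e : v + e *: y1 = place G (vec (1 - e) (3 / 2 * e)).
  by rewrite scalemxAl -placeD vecZ vecD; congr (place G (vec _ _)); ring.
have E2 e : v + e *: y2 = place G (vec (1 + e / 2) (- 3 / 2 * e)).
  by rewrite scalemxAl -placeD vecZ vecD; congr (place G (vec _ _)); ring.
have e4 : 0 < 1 / 4 :> R by lra.
have [e [[H1 H2] [e0 e1]]] := filter_ex (filterI
  (filterI (tiling_locally Ttil v y1) (tiling_locally Ttil v y2))
  (filterI (nbhs_right_gt 0) (nbhs_right_lt e4))).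
have {e4} [h1 Th1 h1e] := tiling_cover Ttil (v + e *: y1).
have [h2 Th2 h2e] := tiling_cover Ttil (v + e *: y2).
have h1v := H1 _ Th1 h1e; have h2v := H2 _ Th2 h2e.
have gh1 : g <> h1.
  move=> gh1; move: h1e; rewrite -gh1 -Gg E1 => /(tileE _ _ Gi).
  by rewrite /inhex; lra.
have gh2 : g <> h2.
  move=> gh2; move: h2e; rewrite -gh2 -Gg E2 => /(tileE _ _ Gi).
  by rewrite /inhex; lra.
have h12 : h1 <> h2.
  move=> h12; subst h2; case: gh1.
  apply: (tiling_disjoint Ttil Tg Th1 (x := place G (vec (1 - e / 4) 0))).
    by rewrite -Gg; apply: inner_interior => //; rewrite /inner; lra.
  have h1i := Tiso Th1; move: h1e h2e.
  have [a [b Ea]] := place_surj (v + e *: y1) h1i.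
  have [c [d Ec]] := place_surj (v + e *: y2) h1i.
  have -> : place G (vec (1 - e / 4) 0) = place h1 (vec ((a + c) / 2) ((b + d) / 2)).
    have -> : vec ((a + c) / 2) ((b + d) / 2) = vec a b + 2^-1 *: (vec c d - vec a b).
      by rewrite vecB vecZ vecD; congr vec; field.
    rewrite placeD -scalemxAl -placeB -Ea -Ec E1 E2 placeB vecB scalemxAl -placeD vecZ vecD.
    by congr (place G (vec _ _)); field.
  rewrite Ea Ec => /(tileE _ _ h1i) A /(tileE _ _ h1i) B; apply/(tileE _ _ h1i).
  by move: A B; rewrite /inhex; lra.
have apart h k : T h -> T k -> h <> k -> 3 <= sqnorm ((ctr h - v) - (ctr k - v)).
  move=> Th Tk hk; rewrite opprB addrA subrK leNgt; apply/negP => /(centers_apart Ttil Th Tk).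
  exact: hk.
have gv : ctr g - v = (- vec 1 0) *m lin G.
  by rewrite -cGg -[ctr G]place0 placeB sub0r.
have gn : sqnorm (ctr g - v) <= 1.
  by rewrite gv sqnorm_isometry // vecN sqnorm_vec; lra.
have h1n := tile_norm (Tiso Th1) h1v; have h2n := tile_norm (Tiso Th2) h2v.
have [] := three_centers gn h1n h2n.
- exact: apart.
- exact: apart.
- by apply: apart => // /esym.
have [a [b E]] := place_surj (ctr h1) Gi.
have h1E : ctr h1 - v = vec (a - 1) b *m lin G.
  by rewrite E placeB vecB subr0.
move=> S n1 n2; have h2E : ctr h2 - v = vec (2 - a) (- b) *m lin G.
  have -> : ctr h2 - v = - (ctr g - v) - (ctr h1 - v).
    by apply/eqP; rewrite -opprD eq_sym eqr_oppLR -addr_eq0 S.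
  rewrite gv h1E mulNmx opprK -mulmxBl vecB; congr (vec _ _ *m _); ring.
have N1 := n1; have N2 := n2.
rewrite h1E sqnorm_isometry // sqnorm_vec in N1.
rewrite h2E sqnorm_isometry // sqnorm_vec in N2.
(* Seen from [v], the centers of [h1] and [h2] have norm 1 and a given sum, so
   that one of them is the required center and the other its mirror image. *)
have bE : b = 3 - 2 * a by lra.
rewrite bE in N1; have : (a - 1) * (a - 2) = 0 by lra.
move/eqP; rewrite mulf_eq0 => /orP[] /eqP aE.
- exists h1 => //; split; first by rewrite E bE; congr (place G (vec _ _)); lra.
  exact: tile_norm1 (Tiso Th1) h1v n1.
- exists h2 => //; split; last exact: tile_norm1 (Tiso Th2) h2v n2.
  rewrite -[ctr h2](subrK v) h2E addrC -placeD vecD bE.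
  by congr (place G (vec _ _)); lra.
Qed.
End Tiling.
End VertexStar.

(** * Every tiling is a lattice tiling *)

Definition turnV (t : orient) (k : 'Z_6) : 'Z_6 :=
  if t.2 then t.1 - k else k - t.1.

Lemma turnK t : cancel (turn t) (turnV t).
Proof. by case: t => r [] k; rewrite /turn /turnV /=; ring. Qed.

Lemma turnVK t : cancel (turnV t) (turn t).
Proof. by case: t => r [] k; rewrite /turn /turnV /=; ring. Qed.

(** Coordinates of the lattice of centers in the basis of [vec]; it has index 3
    in the lattice of all centers and vertices. *)
Definition center_pos (z : int * int) : int * int := (z.1 - z.2, z.1 + 2 * z.2).

Lemma center_posD z w : center_pos (z + w) = center_pos z + center_pos w.
Proof. by case: z w => x y [x' y']; congr (_, _); rewrite /=; ring. Qed.

Lemma center_pos_dir k : center_pos (dir k) = dir k + dir (k + 1).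
Proof. by elim/Z6_ind: k. Qed.

Lemma center_pos_inj : injective center_pos.
Proof. by case=> x y [x' y'] [] E F; congr (_, _); lia. Qed.

Section Lattice.
Variable R : realType.
Implicit Types (a b : R) (x y : plane R) (g h : placement R) (T : set (placement R)).

Lemma hexagon_dihedral t x : hexagon x -> hexagon (x *m dihedral R t).
Proof.
have bij : bijective (turnV t) by exists (turn t); [exact: turnVK | exact: turnK].
case=> w [w0 w1 ->]; exists (w \o turnV t); split=> [k|/=|]; first exact: w0.
  by rewrite -[RHS]w1 [in RHS](reindex (turnV t)) //; exact: onW_bij.
rewrite mulmx_suml [in LHS](reindex (turnV t)) /=; last exact: onW_bij.
by apply: eq_bigr => k _; rewrite -scalemxAl vertex_dihedral turnVK.
Qed.

Lemma tile_dihedral t g :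
  tile (Placement (dihedral R t *m lin g) (ctr g)) = tile g.
Proof.
have sub u h : tile (Placement (dihedral R u *m lin h) (ctr h)) `<=` tile h.
  move=> _ [x hx <-]; exists (x *m dihedral R u); first exact: hexagon_dihedral.
  by rewrite /place /= mulmxA.
apply/seteqP; split; first exact: sub.
have [u E] : exists u, dihedral R u *m dihedral R t = 1%:M.
  exists (turnV t 0, t.2); apply: eq_frame; rewrite mulmxA !vertex_dihedral mulmx1;
  congr vertex; case: t => r []; rewrite /turn /turnV /=; ring.
have := sub u (Placement (dihedral R t *m lin g) (ctr g)).
by rewrite /= mulmxA E mul1mx; case: g.
Qed.

(** The decoration [f z] in the cell [z] of the hexagonal grid that has the
    hexagon placed by [g] as its cell 0. *)
Definition lattice_tile g (f : int * int -> orient) z : placement R :=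
  Placement (dihedral R (f z) *m lin g) (place g (ivec R (center_pos z))).

Definition lattice_tiling g f : set (placement R) := range (lattice_tile g f).

Lemma isometry_quotient (M N : 'M[R]_2) : M *m M^T = 1%:M -> N *m N^T = 1%:M ->
  M *m N^T *m (M *m N^T)^T = 1%:M.
Proof. by move=> Mi Ni; rewrite trmx_mul trmxK mulmxA -(mulmxA M) (mulmx1C Ni) mulmx1. Qed.

Lemma dihedral_mul_isometry t g : is_isometry g ->
  dihedral R t *m lin g *m (dihedral R t *m lin g)^T = 1%:M.
Proof.
move=> gi; rewrite trmx_mul -mulmxA (mulmxA (lin g)) gi mul1mx.
exact: dihedral_isometry.
Qed.

Lemma lattice_tile_isometry g f z : is_isometry g -> is_isometry (lattice_tile g f z).
Proof. exact: dihedral_mul_isometry. Qed.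

(** Up to the lattice [x] lies in a fundamental rhombus, which is covered by the
    cells at its four corners. *)
Lemma lattice_cover x : exists z a b, inhex a b /\ x = ivec R (center_pos z) + vec a b.
Proof.
have [c [d ->]] := vecP x.
pose p := (2 * c + d) / 3; pose q := (d - c) / 3.
pose m := Num.floor p; pose n := Num.floor q.
have pm := floor_itv p; have qn := floor_itv q; rewrite -/m -/n !intrD in pm qn.
have [i [j H]] : exists i j : int,
    inhex ((p - m%:~R - i%:~R) - (q - n%:~R - j%:~R))
          ((p - m%:~R - i%:~R) + 2 * (q - n%:~R - j%:~R)).
  have {pm qn} : 0 <= p - m%:~R < 1 /\ 0 <= q - n%:~R < 1 by lra.
  move: (p - m%:~R) (q - n%:~R) => u v [hu hv]; rewrite /inhex.
  have [uv|vu] := leP v u.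
    have [l|l] := leP (2 * u + v) 1; first by exists 0, 0; lra.
    have [k|k] := leP (u + 2 * v) 2; first by exists 1, 0; lra.
    by exists 1, 1; lra.
  have [l|l] := leP (u + 2 * v) 1; first by exists 0, 0; lra.
  have [k|k] := leP (2 * u + v) 2; first by exists 0, 1; lra.
  by exists 1, 1; lra.
exists (m + i, n + j); eexists; eexists; split; first exact: H.
rewrite /ivec vecD /= !(intrD, intrB, intrM) /p /q; congr vec; by field.
Qed.

(** Starting from one tile, each tile forces its six neighbors, so that every
    cell of the grid holds a tile; any tile has its center at distance at most 1
    from the center of a cell, hence occupies that cell. *)
Theorem tiling_is_lattice T : is_tiling T ->
  exists g f, is_isometry g /\ T = lattice_tiling g f.
Proof.
move=> Ttil; have Tiso g : T g -> is_isometry g by case: Ttil => + _ _; apply.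
have [g Tg _] := tiling_cover Ttil 0; have gi := Tiso _ Tg.
pose P z := exists t, T (Placement (dihedral R t *m lin g) (place g (ivec R (center_pos z)))).
have all z : P z.
  elim/lattice_ind: z => [|z k [t Tt]].
    by exists (0, false); rewrite dihedral1 mul1mx ivec0 place0; case: g Tg {gi P}.
  set g' := Placement _ _ in Tt.
  pose G := Placement (dihedral R (k, false) *m lin g) (ctr g').
  have Gi : is_isometry G by exact: dihedral_mul_isometry.
  have GE u : place G (ivec R u) =
      place g (ivec R (center_pos z) + ivec R u *m dihedral R (k, false)).
    by rewrite placeD addrC -mulmxA.
  have v0 : ivec R (1, 0) *m dihedral R (k, false) = ivec R (dir k).
    by rewrite -(vertexE R 0) vertex_dihedral vertexE /turn /= addr0.
  have v1 : ivec R (0, 1) *m dihedral R (k, false) = ivec R (dir (k + 1)).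
    by rewrite -(vertexE R 1) vertex_dihedral vertexE.
  have tG : tile G = tile g'.
    transitivity (tile (Placement (lin g) (ctr g'))).
      exact: (tile_dihedral _ (Placement (lin g) (ctr g'))).
    exact/esym/(tile_dihedral _ (Placement (lin g) (ctr g'))).
  have [h Th [hc [j jh]]] := tiling_star Ttil Tt Gi tG erefl.
  have hi := Tiso _ Th.
  have cE : ctr h = place g (ivec R (center_pos (z + dir k))).
    have : ivec R (1, 1) = ivec R (1, 0) + ivec R (0, 1) by rewrite -ivecD.
    rewrite hc -[vec 1 1]/(ivec R (1, 1)) GE => ->.
    by rewrite mulmxDl v0 v1 -!ivecD center_posD center_pos_dir.
  have [u uE] : exists u, lin h *m (lin G)^T = dihedral R u.
    apply: (@dihedral_align R _ j).
      exact: isometry_quotient hi Gi.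
    rewrite mulmxA.
    have -> : vertex R j *m lin h = place G (vec 1 0) - place G (vec 1 1).
      by rewrite -jh -hc /tile_vertex /place addrK.
    rewrite placeB -mulmxA Gi mulmx1 vecB vertexE /ivec /dir /=; congr vec; ring.
  have [u' u'E] := dihedral_comp R u (k, false).
  exists u'; rewrite -u'E -mulmxA -cE.
  have -> : Placement (dihedral R u *m (dihedral R (k, false) *m lin g)) (ctr h) = h.
    rewrite -uE -mulmxA -[_ *m lin g]/(lin G) (mulmx1C Gi) mulmx1; by case: (h).
  exact: Th.
have [f fE] := choice all.
exists g, f; split => //; apply/seteqP; split=> [h Th | _ [z _ <-]]; last exact: fE.
have hi := Tiso _ Th.
have [a [b hE]] := place_surj (ctr h) gi.
have [z [c [d [cd zE]]]] := lattice_cover (vec a b); rewrite zE in hE.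
exists z => //; apply: (centers_apart Ttil) => //; first exact: fE.
rewrite hE /= place_dist // opprD addNKr -[X in _ < X]/(3) vecN.
by have := inhex_norm cd; rewrite !sqnorm_vec; lra.
Qed.

End Lattice.

(** * The color rule on lattice tilings *)

(** A vertex belongs to three cells, in positions that are pairwise congruent
    modulo 2. *)
Lemma shared_vertex z w j k : center_pos w + dir j = center_pos z + dir k ->
  [\/ w = z /\ j = k, w = z + dir k /\ j = k + 4 | w = z + dir (k + 5) /\ j = k + 2].
Proof.
have E (a b c d : int) : (a, b) + (c, d) = (a + c, b + d) by [].
case: z w => x y [x' y']; rewrite /center_pos /=.
by elim/Z6_ind: j; elim/Z6_ind: k; rewrite /dir /= !E => -[] ? ?;
  (exfalso; lia) || (by apply: Or31; split; [congr (_, _); lia | apply/eqP])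
  || (by apply: Or32; split; [congr (_, _); lia | apply/eqP])
  || (by apply: Or33; split; [congr (_, _); lia | apply/eqP]).
Qed.

Section Rules.
Variable R : realType.
Implicit Types (a b : R) (x y : plane R) (g h : placement R).

Definition aligned g z : placement R :=
  Placement (lin g) (place g (ivec R (center_pos z))).

Lemma tile_lattice g f z : tile (lattice_tile g f z) = tile (aligned g z).
Proof. exact: (tile_dihedral (f z) (aligned g z)). Qed.

Lemma place_aligned g z y : place (aligned g z) y = place g (ivec R (center_pos z) + y).
Proof. by rewrite placeD addrC. Qed.

(** If two cells have a common interior point, the coordinates of the difference
    of their centers are integers congruent modulo 3, less than 2 in absolute
    value together with their sum: they vanish. *)
Lemma lattice_is_tiling g f : is_isometry g -> is_tiling (lattice_tiling g f).
Proof.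
move=> gi; split.
- by move=> _ [z _ <-]; exact: lattice_tile_isometry.
- apply/seteqP; split=> // x _; have [a [b ->]] := place_surj x gi.
  have [z [c [d [cd ->]]]] := lattice_cover (vec a b).
  exists (lattice_tile g f z); first by exists z.
  by rewrite tile_lattice -place_aligned; apply/tileE.
move=> _ _ [z _ <-] [z' _ <-] [x []]; rewrite !tile_lattice.
have zi : is_isometry (aligned g z) by [].
have zi' : is_isometry (aligned g z') by [].
have [a [b E]] := place_surj x zi; have [a' [b' E']] := place_surj x zi'.
rewrite {1}E E' => /(interior_inner zi) h /(interior_inner zi') h'.
congr lattice_tile.
move: E'; rewrite E !place_aligned => /(place_inj gi); rewrite /ivec !vecD => /vec_inj[].
case: z z' {zi zi' E} => x1 y1 [x2 y2] /= Ea Eb.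
move: h h'; rewrite /inner => h h'.
pose p := x1 - x2; pose q := y1 - y2.
have P : (p - q)%:~R = a' - a by rewrite /p /q; rewrite !intrB in Ea *; lra.
have Q : (p + 2 * q)%:~R = b' - b by rewrite /p /q; rewrite !(intrD, intrM, intrB) in Eb *; lra.
have i1 : (-2 < p - q)%R by rewrite -(ltr_int R) P; lra.
have i2 : (p - q < 2)%R by rewrite -(ltr_int R) P; lra.
have i3 : (-2 < p + 2 * q)%R by rewrite -(ltr_int R) Q; lra.
have i4 : (p + 2 * q < 2)%R by rewrite -(ltr_int R) Q; lra.
have i5 : (-2 < (p - q) + (p + 2 * q))%R by rewrite -(ltr_int R) intrD P Q; lra.
have i6 : ((p - q) + (p + 2 * q) < 2)%R by rewrite -(ltr_int R) intrD P Q; lra.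
have [pq0 pq1] : p = 0 /\ q = 0.
  by clear - i1 i2 i3 i4 i5 i6; lia.
by congr (_, _); apply/eqP; rewrite -subr_eq0; apply/eqP; [exact: pq0|exact: pq1].
Qed.

(** Centers and vertices of the grid, with integral coordinates. *)
Definition corner g (u : int * int) : plane R := place g (ivec R u).

Lemma corner_inj g : is_isometry g -> injective (corner g).
Proof. by move=> gi u w /(place_inj gi)/ivec_inj. Qed.

Lemma lattice_place g f z x :
  place (lattice_tile g f z) x = place g (ivec R (center_pos z) + x *m dihedral R (f z)).
Proof. by rewrite placeD addrC -mulmxA. Qed.

Lemma lattice_vertex g f z k :
  tile_vertex (lattice_tile g f z) k = corner g (center_pos z + dir (turn (f z) k)).
Proof. by rewrite /tile_vertex lattice_place vertex_dihedral vertexE -ivecD. Qed.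

(** [p] and [q] are the ends, in positions [k] and [k + 1], of an edge of cell
    [z].  Positions, unlike the indices of the vertices of the prototile, do not
    depend on the decoration of the cell. *)
Definition edge_at g z k (p q : plane R) : Prop :=
  p = corner g (center_pos z + dir k) /\ q = corner g (center_pos z + dir (k + 1)).

Lemma turn_edge t k :
  turn t (k + 1) = turn t k + 1 \/ turn t k = turn t (k + 1) + 1.
Proof. by case: t => r []; rewrite /turn /=; [right|left]; ring. Qed.

Lemma turn_onto_edge t k : exists j, turn t j = k /\ turn t (j + 1) = k + 1 \/
  turn t j = k + 1 /\ turn t (j + 1) = k.
Proof.
by case: t => r []; [exists (r - k - 1); right | exists (k - r); left];
  rewrite /turn /=; split; ring.
Qed.

Lemma lattice_edge g f z p q :
  tile_edge (lattice_tile g f z) p q <-> exists k, edge_at g z k p q \/ edge_at g z k q p.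
Proof.
split=> [[k]|[k]]; rewrite /edge_at ?lattice_vertex.
  by case: (turn_edge (f z) k) => ->;
    [exists (turn (f z) k) | exists (turn (f z) (k + 1))]; tauto.
have [j jk] := turn_onto_edge (f z) k.
by exists j; rewrite !lattice_vertex; case: jk => -[-> ->]; tauto.
Qed.

Lemma shared_edge g z w k l p q : is_isometry g -> 
  edge_at g z k p q \/ edge_at g z k q p -> edge_at g w l p q \/ edge_at g w l q p ->
  w = z \/ (w = z + dir k /\ l = k + 3).
Proof.
move=> gi; wlog : p q / edge_at g z k p q => [wl|H _].
  by case=> H K; [apply: (wl p q) | apply: (wl q p)]; tauto.
case: H => [-> ->] [] [/(corner_inj gi)/esym A /(corner_inj gi)/esym B].
  case: (shared_vertex A) => -[wE lE]; [by left | ..];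
  case: (shared_vertex B) => -[wE' lE']; try (by left);
  by exfalso; move: wE' lE'; rewrite wE lE => /addrI/eqP + /eqP; clear; elim/Z6_ind: k.
case: (shared_vertex B) => -[wE lE]; first by left.
  by right; split => //; apply: (addIr 1); rewrite lE; Z6 k.
case: (shared_vertex A) => -[wE' lE']; first by left.
all: by exfalso; move: lE; rewrite lE' => /eqP; clear; elim/Z6_ind: k.
Qed.

(** Of the three cells at an end of an edge, the two that contain the edge are
    excluded. *)
Lemma opposite_tile_start g z k w i p q : is_isometry g -> edge_at g z k p q ->
  corner g (center_pos w + dir i) = p ->
  (forall l, ~ edge_at g w l p q /\ ~ edge_at g w l q p) -> w = z + dir (k + 5) /\ i = k + 2.
Proof.
move=> gi pq ip no; have [pE qE] := pq; move: ip; rewrite pE => /(corner_inj gi) E.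
case: (shared_vertex E) => -[wE iE] //.
  by subst w; case: (no k).
case: (no (k + 3)) => _ []; rewrite /edge_at pE qE wE !center_posD center_pos_dir.
by split; congr corner; rewrite -!addrA; congr (_ + _); Z6 k.
Qed.

Lemma opposite_tile_end g z k p q : is_isometry g -> edge_at g z k q p ->
  forall w i, corner g (center_pos w + dir i) = p ->
  (forall l, ~ edge_at g w l p q /\ ~ edge_at g w l q p) -> w = z + dir (k + 1) /\ i = k + 5.
Proof.
move=> gi pq w i ip no; have [qE pE] := pq; move: ip; rewrite pE => /(corner_inj gi) E.
case: (shared_vertex E) => -[wE iE].
- by subst w; case: (no k).
- by split=> //; rewrite iE; Z6 k.
case: (no (k + 3)) => []; rewrite /edge_at pE qE wE !center_posD.
have -> : k + 1 + 5 = k by Z6 k.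
rewrite center_pos_dir => [[]].
by split; congr corner; rewrite -!addrA; congr (_ + _); Z6 k.
Qed.

(** Seen in the frame of [g], colors are exchanged globally if [g] is a
    reflection, which is invisible to the color rule. *)
Lemma tile_half_color_lattice g f z k : is_isometry g ->
  tile_half_color (lattice_tile g f z) (turnV (f z) k) =
  (if reverses_orientation g then swap_color (shade (f z) k) else shade (f z) k).
Proof.
move=> gi; have dg : \det (lin g) ^+ 2 = 1.
  by rewrite expr2 -{2}det_tr -det_mulmx gi det1.
rewrite /tile_half_color /reverses_orientation /= det_mulmx det_dihedral.
have dg0 : \det (lin g) = 1 \/ \det (lin g) = -1.
  by move/eqP: dg; rewrite sqrf_eq1 => /orP[] /eqP; [left|right].
rewrite /shade /turnV; case: (f z) => r [] /=; case: dg0 => ->;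
  rewrite ?expr0 ?expr1 ?mulrNN ?mulr1 ?mul1r ?mulN1r ?ltrN10 ?ltr10 ?oppr_lt0 ?ltr01 //.
all: by case: half_color.
Qed.

Lemma not_edge g f w p q : ~ tile_edge (lattice_tile g f w) p q ->
  forall l, ~ edge_at g w l p q /\ ~ edge_at g w l q p.
Proof. by move=> /lattice_edge ne l; split=> jl; case: ne; exists l; tauto. Qed.

Lemma half_colors_differ g f z w k l : is_isometry g ->
  tile_half_color (lattice_tile g f z) (turnV (f z) k) <>
    tile_half_color (lattice_tile g f w) (turnV (f w) l) <->
  shade (f z) k <> shade (f w) l.
Proof.
move=> gi; rewrite !tile_half_color_lattice //; case: reverses_orientation => //.
by case: (shade (f z) k); case: (shade (f w) l).
Qed.

(** The two half-diameters facing each other across an edge from position [k] to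
    [k + 1] of [z] belong to the cells [z + dir (k + 5)] and [z + dir (k + 1)]. *)
Lemma lattice_R2 g f : is_isometry g ->
  rule_R2 (lattice_tiling g f) <->
  forall z k, shade (f (z + (dir k + dir (k + 5)))) (k + 3) <> shade (f z) k.
Proof.
move=> gi; split=> [r2 z k | r2].
  pose w := z + (dir k + dir (k + 5)).
  pose p := corner g (center_pos z + dir k).
  pose q := corner g (center_pos z + (dir k + dir k)).
  have wE u : center_pos w + u = center_pos z + (dir k + dir k + dir k + u).
    rewrite /w !center_posD !center_pos_dir -!addrA; congr (_ + _).
    by rewrite !addrA; congr (_ + _); Z6 k.
  have edge_pq : tile_edge (lattice_tile g f (z + dir k)) p q.
    apply/lattice_edge; exists (k + 4); left; rewrite /edge_at center_posD center_pos_dir.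
    by split; congr corner; rewrite -!addrA; congr (_ + _); Z6 k.
  have zp : tile_vertex (lattice_tile g f z) (turnV (f z) k) = p.
    by rewrite lattice_vertex turnVK.
  have wq : tile_vertex (lattice_tile g f w) (turnV (f w) (k + 3)) = q.
    by rewrite lattice_vertex turnVK wE; congr corner; congr (_ + _); Z6 k.
  have nz : ~ tile_edge (lattice_tile g f z) p q.
    move=> /lattice_edge[l]; rewrite /edge_at.
    suff n m : q <> corner g (center_pos z + dir m) by case=> -[A B]; [exact: n B | exact: n A].
    by move=> /(corner_inj gi)/addrI/eqP; clear; elim/Z6_ind: k; elim/Z6_ind: m.
  have nw : ~ tile_edge (lattice_tile g f w) p q.
    move=> /lattice_edge[l]; rewrite /edge_at.
    suff n m : p <> corner g (center_pos w + dir m) by case=> -[A B]; [exact: n A | exact: n B].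
    by rewrite wE => /(corner_inj gi)/addrI/eqP; clear; elim/Z6_ind: k; elim/Z6_ind: m.
  have := r2 _ p q (ex_intro2 _ _ (z + dir k) I erefl) edge_pq _ _
    (ex_intro2 _ _ z I erefl) zp nz _ _ (ex_intro2 _ _ w I erefl) wq nw.
  by move/half_colors_differ => /(_ gi) ne E; apply: ne.
move=> _ p q [z _ <-] /lattice_edge[k pq] _ i [w _ <-] + /not_edge np _ j [v _ <-] + /not_edge nq.
rewrite !lattice_vertex -{2}(turnK (f w) i) -{2}(turnK (f v) j) => wp vq.
apply/half_colors_differ => //.
have sym u (e e' : plane R) : (forall l, ~ edge_at g u l e e' /\ ~ edge_at g u l e' e) ->
    forall l, ~ edge_at g u l e' e /\ ~ edge_at g u l e e'.
  by move=> H l; have [] := H l.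
have r2' : shade (f (z + dir (k + 1))) (k + 5) <> shade (f (z + dir (k + 5))) (k + 2).
  have := r2 (z + dir (k + 5)) (k + 2).
  have -> : z + dir (k + 5) + (dir (k + 2) + dir (k + 2 + 5)) = z + dir (k + 1).
    by rewrite -!addrA; congr (_ + _); Z6 k.
  by have -> : k + 2 + 3 = k + 5 by Z6 k.
case: pq => pq.
  have [-> ->] := opposite_tile_start gi pq wp np.
  have [-> ->] := opposite_tile_end gi pq vq (sym _ _ _ nq).
  exact/nesym.
have [-> ->] := opposite_tile_start gi pq vq (sym _ _ _ nq).
have [-> ->] := opposite_tile_end gi pq wp np.
exact: r2'.
Qed.
End Rules.

(** * The stripe rule on lattice tilings *)

Section Stripes.
Variable R : realType.
Implicit Types (a b : R) (x y : plane R) (g h : placement R).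

(** The ends of the black stripes: [(i, j)] is the marked point near vertex [i]
    of the edge from [i] to [j]. *)
Definition ends : seq ('Z_6 * 'Z_6) :=
  [:: (0, 5); (0, 1); (3, 2); (3, 4); (1, 2); (5, 4)].

Lemma black_endsE (d : R) x :
  black_ends d x <-> exists2 ij, ij \in ends & x = mark d ij.1 ij.2.
Proof.
rewrite /black_ends /=; split.
  by rewrite !inE => /or4P[/eqP->|/eqP->|/eqP->|/or3P[/eqP->|/eqP->|/eqP->]];
   [exists (0, 5)|exists (3, 2)|exists (1, 2)|exists (0, 1)|exists (3, 4)|exists (5, 4)].
by case=> ij + ->; rewrite !inE => /or4P[/eqP->|/eqP->|/eqP->|/or3P[/eqP->|/eqP->|/eqP->]];
  rewrite eqxx ?orbT.
Qed.

Lemma mark_dihedral d i j t :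
  mark d i j *m dihedral R t = mark d (turn t i) (turn t j).
Proof.
by rewrite /mark mulmxDl -scalemxAl mulmxBl !vertex_dihedral.
Qed.

(** The end of a stripe on the edge from position [k] to [k + 1], in the format
    of [ends]. *)
Definition stripe_end (t : orient) (k : 'Z_6) : 'Z_6 * 'Z_6 :=
  if toward t.1 k then (k + 1, k) else (k, k + 1).

Lemma ends_turn t ij : ij \in ends ->
  exists k, (turn t ij.1, turn t ij.2) = stripe_end t k.
Proof.
move=> ije; exists (if turn t ij.2 == turn t ij.1 + 1 then turn t ij.1 else turn t ij.2).
by move: ije; rewrite !inE => /or4P[/eqP->|/eqP->|/eqP->|/or3P[/eqP->|/eqP->|/eqP->]];
  apply/eqP; case: t => r []; elim/Z6_ind: r.
Qed.

Lemma turn_ends t k : exists2 ij, ij \in ends & (turn t ij.1, turn t ij.2) = stripe_end t k.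
Proof.
exists (turnV t (stripe_end t k).1, turnV t (stripe_end t k).2).
  by case: t => r []; elim/Z6_ind: r; elim/Z6_ind: k.
by rewrite !turnVK; case: (stripe_end t k).
Qed.

Lemma lattice_black_ends d g f z x : 
  tile_black_ends d (lattice_tile g f z) x <->
  exists k, x = place g (ivec R (center_pos z) +
    mark d (stripe_end (f z) k).1 (stripe_end (f z) k).2).
Proof.
split=> [[_ /black_endsE[ij ije ->] <-]|[k ->]].
  have [k E] := ends_turn (f z) ije.
  by exists k; rewrite lattice_place mark_dihedral -E.
have [ij ije E] := turn_ends (f z) k.
exists (mark d ij.1 ij.2); first by apply/black_endsE; exists ij.
by rewrite lattice_place mark_dihedral -E.
Qed.

Definition edge_point (e : R) k := mark e k (k + 1).

Lemma stripe_endE d t k : mark d (stripe_end t k).1 (stripe_end t k).2 =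
  edge_point (if toward t.1 k then 1 - d else d) k.
Proof.
rewrite /stripe_end /edge_point; case: toward => //=; rewrite /mark.
by rewrite scalerBl scale1r addrA (addrC (vertex R k)) subrK -scalerN opprB.
Qed.

Lemma edge_pointE e k : edge_point e k =
  vec ((dir k).1%:~R + e * (dir (k + 2)).1%:~R) ((dir k).2%:~R + e * (dir (k + 2)).2%:~R).
Proof.
rewrite /edge_point /mark !vertexE -ivecN -ivecD.
have -> : dir (k + 1) - dir k = dir (k + 2) by Z6 k.
by rewrite /ivec vecZ vecD.
Qed.

(** As [e] is neither 0 nor 1, the point is no vertex and determines its edge. *)
Lemma edge_point_inj e e' k l : 0 < e < 1 -> 0 <= e' <= 1 ->
  edge_point e k = edge_point e' l -> k = l /\ e = e'.
Proof.
move=> e01 e01'; rewrite !edge_pointE => /vec_inj[].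
by elim/Z6_ind: k; elim/Z6_ind: l; rewrite /dir /= => E F;
  (split; [by [] | lra]) || (exfalso; lra).
Qed.

Lemma edge_point_across e e' z k l : 0 < e < 1 -> 0 < e' < 1 ->
  ivec R (center_pos z) + edge_point e k = ivec R (center_pos (z + dir k)) + edge_point e' l ->
  l = k + 3 /\ e' = 1 - e.
Proof.
move=> e01 e01'; rewrite center_posD ivecD -(addrA (ivec R (center_pos z))).
move/(@addrI _ _); rewrite center_pos_dir !edge_pointE /ivec vecD => /vec_inj[].
by elim/Z6_ind: k; elim/Z6_ind: l; rewrite /dir /= => E F;
  (split; [exact/eqP | lra]) || (exfalso; lra).
Qed.

Lemma segmentC (p q : plane R) : segment p q = segment q p.
Proof.
apply/seteqP; split=> _ [t [t01 ->]]; exists (1 - t);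
  by split; [lra | apply: planeP; rewrite !mxE; ring].
Qed.

Lemma edge_point_opp e k :
  edge_point (1 - e) (k + 3) + ivec R (dir k + dir (k + 1)) = edge_point e k.
Proof.
by rewrite !edge_pointE /ivec vecD; elim/Z6_ind: k; rewrite /dir /=; congr vec; ring.
Qed.

Lemma edge_at_across g z k p q : edge_at g z k p q ->
  edge_at g (z + dir k) (k + 3) q p.
Proof.
case=> -> ->; rewrite /edge_at center_posD center_pos_dir.
by split; congr corner; rewrite -!addrA; congr (_ + _); Z6 k.
Qed.

(** On the edge from position [k] to [k + 1] a tile has exactly one stripe end,
    at parameter [d] or [1 - d]; these differ as [d < 1 / 2], and the neighbor
    parametrizes the same edge backwards. *)
Lemma lattice_R1 d g f : 0 < d < 1 / 2 -> is_isometry g ->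
  rule_R1 d (lattice_tiling g f) <->
  forall z k, toward (f (z + dir k)).1 (k + 3) = ~~ toward (f z).1 k.
Proof.
move=> d01 gi; have side (b : bool) : 0 < (if b then 1 - d else d) < 1 by case: b; lra.
have segE z k p q : edge_at g z k p q -> forall x, segment p q x <->
    exists2 e, 0 <= e <= 1 & x = place g (ivec R (center_pos z) + edge_point e k).
  move=> [-> ->] x; rewrite /segment /corner /edge_point /mark !vertexE !ivecD.
  set c := ivec R (center_pos z); set u := ivec R (dir k); set w := ivec R (dir (k + 1)).
  have E e : place g (c + (u + e *: (w - u))) =
      place g (c + u) + e *: (place g (c + w) - place g (c + u)).
    by rewrite placeB (addrC _ w) addrKA scalemxAl -placeD addrA.
  by split=> [[e [e01 ->]]|[e e01 ->]]; exists e; rewrite ?E.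
split=> [r1 z k | r1].
  pose p := corner g (center_pos z + dir k).
  pose q := corner g (center_pos z + dir (k + 1)).
  have pq : edge_at g z k p q by [].
  have pq' := edge_at_across pq.
  pose e := if toward (f z).1 k then 1 - d else d.
  pose x := place g (ivec R (center_pos z) + edge_point e k).
  have xz : tile_black_ends d (lattice_tile g f z) x.
    by apply/lattice_black_ends; exists k; rewrite stripe_endE.
  have xs : segment p q x.
    by apply/(segE _ _ _ _ pq); exists e => //; have := side (toward (f z).1 k); rewrite -/e; lra.
  have : (tile_black_ends d (lattice_tile g f (z + dir k)) `&` segment p q) x.
    rewrite -(r1 (lattice_tile g f z) _ _ _ (ex_intro2 _ _ z I erefl)
       (ex_intro2 _ _ (z + dir k) I erefl)) //.
      by apply/lattice_edge; exists k; left.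
    by apply/lattice_edge; exists (k + 3); right.
  case=> /lattice_black_ends[l]; rewrite stripe_endE => /(place_inj gi) E _.
  have [lE] := edge_point_across (side _) (side _) E.
  by rewrite lE; case: toward; case: toward => //=; lra.
have sub z w k p q x : edge_at g z k p q -> edge_at g w (k + 3) q p -> w = z + dir k ->
    (tile_black_ends d (lattice_tile g f z) `&` segment p q) x ->
    tile_black_ends d (lattice_tile g f w) x.
  move=> zpq wpq wE [/lattice_black_ends[l ->]].
  rewrite stripe_endE => /(segE _ _ _ _ zpq)[e e01 /(place_inj gi)/addrI E].
  have [lk _] := edge_point_inj (side _) e01 E; subst l.
  apply/lattice_black_ends; exists (k + 3); rewrite stripe_endE wE r1.
  rewrite center_posD center_pos_dir ivecD -(addrA (ivec R (center_pos z))).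
  congr (place g (_ + _)).
  rewrite [RHS]addrC -(edge_point_opp _ k); congr (edge_point _ _ + _).
  by case: toward => //=; ring.
have main z k p q : edge_at g z k p q ->
    tile_black_ends d (lattice_tile g f z) `&` segment p q =
    tile_black_ends d (lattice_tile g f (z + dir k)) `&` segment p q.
  move=> zpq; have wqp := edge_at_across zpq; apply/seteqP; split=> x [xb xs].
    by split => //; exact: (sub _ _ _ _ _ _ zpq wqp).
  have E : z + dir k + dir (k + 3) = z by rewrite (dirN k) addrK.
  split => //; rewrite -[X in lattice_tile g f X]E.
  by apply: (sub _ _ _ _ _ _ wqp (edge_at_across wqp) erefl); rewrite segmentC.
move=> _ _ p q [z _ <-] [w _ <-] /lattice_edge[k zk] /lattice_edge[l wl].
have [->//|[-> _]] := shared_edge gi zk wl.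
by case: zk => zk; [exact: main | rewrite segmentC; exact: main].
Qed.
End Stripes.

Lemma dihedral_inj (R : realType) : injective (dihedral R).
Proof.
move=> t u E; have ET k : turn t k = turn u k.
  have : vertex R (turn t k) = vertex R (turn u k).
    by rewrite -!vertex_dihedral E.
  rewrite !vertexE => /ivec_inj/eqP.
  by move: (turn t k) (turn u k) => a b ab; apply/eqP; move: ab; elim/Z6_ind: a; elim/Z6_ind: b.
have := ET 1; have := ET 0; case: t u {E ET} => r b [r' b'].
by case: b; case: b'; rewrite /turn /= ?addr0 ?subr0 => -> // /eqP; elim/Z6_ind: r'.
Qed.

(** * Existence and nonperiodicity *)
Theorem theorem1 (R : realType) (d : R) (hd : 0 < d < 1 / 2) :
  (exists T : set (placement R),
     [/\ is_tiling T, rule_R1 d T & rule_R2 T]) /\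
  (forall T : set (placement R),
     is_tiling T -> rule_R1 d T -> rule_R2 T -> ~ periodic_tiling T).
Proof.
split.
  pose g : placement R := Placement 1%:M 0.
  have gi : is_isometry g by rewrite /is_isometry trmx1 mulmx1.
  have [m1 m2] := toeplitz_matching.
  exists (lattice_tiling g toeplitz); split; first exact: lattice_is_tiling.
    by apply/lattice_R1.
  by apply/lattice_R2.
move=> T Ttil r1 r2 [t [t0 tT]].
have [g [f [gi TE]]] := tiling_is_lattice Ttil; subst T.
have fM : matching f by split; [exact/(lattice_R1 f hd gi) | exact/(lattice_R2 f gi)].
have shifted z : exists w, translate t (lattice_tile g f z) = lattice_tile g f w.
  have : lattice_tiling g f (translate t (lattice_tile g f z)).
    by rewrite -{1}tT; exists (lattice_tile g f z) => //; exists z.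
  by case=> w _ <-; exists w.
have [w wE] := shifted 0.
have tE : t = ivec R (center_pos w) *m lin g.
  have [_ /eqP] := wE; rewrite addrC eq_sym -subr_eq => /eqP <-.
  by rewrite placeB ivec0 subr0.
have w0 : w = 0.
  apply: (matching_nonperiodic fM) => z; have [u uE] := shifted z.
  have [lE sE] := uE.
  have -> : z + w = u.
    apply/center_pos_inj/(@ivec_inj R)/(place_inj gi).
    by rewrite -sE tE -placeD -ivecD -center_posD.
  apply/esym; apply: (@dihedral_inj R).
  have := congr1 (fun M => M *m (lin g)^T) lE.
  by rewrite -!mulmxA gi !mulmx1.
by apply: t0; rewrite tE w0 ivec0 mul0mx.
Qed.
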